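(* Let $V$ be a vector space over an algebraically closed field $k$ (of any characteristic), let $f_1,\dots,f_r$ be homogeneous elements of $P(V)$ of positive degree having infinite collective strength, and let $c_1,\dots,c_r\in k$. Then there exists $v\in V$ with $f_i(v)=c_i$ for all $1\le i\le r$.
   Context: For a $k$-vector space $V$ with basis $\{v_i\}_{i\in I}$ and dual coordinates $x_i$, $P_n(V)$ is the space of degree-$n$ polynomial functions on $V$: formal, possibly infinite, $k$-linear combinations of degree-$n$ monomials in the $x_i$, which can be evaluated at any $v\in V$. $P(V)=\bigoplus_{n\ge0}P_n(V)$. The strength of a homogeneous $f\in P_n(V)$, $n\ge1$, is the least $s$ with $f=\sum_{i=1}^s g_ih_i$, $g_i,h_i$ homogeneous in $P(V)$ of positive degree less than $n$ ($\infty$ if none exists); in particular nonzero linear forms have infinite strength. A collection of elements of $P(V)$ has infinite collective strength if every nontrivial $k$-linear combination of those members having a common degree has infinite strength. *)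

(* Defs.v *)
From mathcomp Require Import all_boot all_algebra.
From mathcomp Require Import finmap multiset.

Set Implicit Arguments.
Unset Strict Implicit.
Unset Printing Implicit Defensive.

Import GRing.Theory.
Local Open Scope ring_scope.
Local Open Scope fset_scope.

(* Setting: V = k^(I), the k-vector space with basis (v_i)_{i in I},
   i.e. finitely supported functions I -> k.  A monomial in the dual
   coordinates x_i is a finite multiset of indices (x_i^e <-> i with
   multiplicity e).  A formal (possibly infinite) k-linear combination of
   monomials is a coefficient function  {mset I} -> k ; an element of P_n(V)
   is such a function supported on monomials of degree n. *)

Section PolyFun.
Variables (k : fieldType) (I : choiceType).

Definition vect := {fsfun I -> k with 0}.
Definition mon := {mset I}%mset.
Definition series := mon -> k.

Definition mdeg (m : mon) : nat := (\sum_(i <- finsupp m) m i)%N.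

Definition homog (n : nat) (f : series) : Prop :=
  forall m : mon, f m != 0 -> mdeg m = n.

(* all sub-multisets A of m with support in the (duplicate-free) list s *)
Fixpoint submsets (s : seq I) (m : mon) : seq mon :=
  match s with
  | [::] => [:: mset0]
  | i :: s' => flatten [seq [seq (msetn j i `+` A)%mset | A <- submsets s' m]
                       | j <- iota 0 (m i).+1]
  end.

Definition smul (g h : series) : series :=
  fun m => \sum_(A <- submsets (finsupp m) m) g A * h (m `\` A)%mset.

Definition monos (s : seq I) (n : nat) : seq mon :=
  [seq A <- submsets s (foldr (fun i M => msetn n i `+` M) mset0 s)%mset
     | mdeg A == n].

Definition mon_eval (m : mon) (v : vect) : k :=
  \prod_(i <- finsupp m) v i ^+ m i.

(* evaluation at v of a homogeneous f of degree n: only the finitely many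
   monomials in the variables of the support of v contribute *)
Definition peval (n : nat) (f : series) (v : vect) : k :=
  \sum_(m <- monos (finsupp v) n) f m * mon_eval m v.

Definition strength_le (n : nat) (f : series) (s : nat) : Prop :=
  exists (g h : 'I_s -> series) (dg dh : 'I_s -> nat),
    (forall j, [/\ (0 < dg j < n)%N, (0 < dh j < n)%N,
                   homog (dg j) (g j) & homog (dh j) (h j)]) /\
    f = (fun m => \sum_(j < s) smul (g j) (h j) m).

Definition infinite_strength (n : nat) (f : series) : Prop :=
  forall s : nat, ~ strength_le n f s.

Definition inf_coll_strength (r : nat) (d : 'I_r -> nat)
    (f : 'I_r -> series) : Prop :=
  forall (n : nat) (a : 'I_r -> k),
    (exists i, d i = n /\ a i != 0) ->
    infinite_strength n (fun m => \sum_(i < r | d i == n) a i * f i m).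

End PolyFun.

(* Main.v *)
Require Import Defs.
From mathcomp Require Import all_boot all_algebra.
From mathcomp Require Import finmap multiset.
From Stdlib Require Import FunctionalExtensionality ClassicalEpsilon Classical.

(* Since k is infinite, elements of P_n(V) are treated as functions on V. Let A be the
   algebra generated by the forms of degree < d. The heart of the proof is that a form F of
   degree d vanishing on the common zeros of finitely many forms h of degree <= d lies in
   A + span(h of degree d).

   First, F is integral over B = A[h of degree d]. Eliminate a form g of top degree e among
   the h: if g does not vanish on the zeros of the others, pick such a zero u with
   g(u) <> 0. Then g(v + t u) has degree e in t, so that after imposing on v the
   vanishing of the other h and of their derivatives along u (which have lower degree)
   some v + t u is a zero of all h, with t integral over B.

   Second, B is closed under p-th roots of forms and, as in the proof of Erman, Sam and
   Snowden that P(V) is a polynomial ring, a form F of degree d which is algebraic over B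
   lies in B: the minimal relation is invariant under translations, hence equal to
   (X - F)^n, so some p-power of F is in B.

   The f_i are then solved for in the order of increasing degree: having found v for the
   previous ones, add to v a common zero w of the previous f_j and of all mixed
   terms of f_j(w + v), at which f_i does not vanish, suitably scaled. *)

Set Implicit Arguments.
Unset Strict Implicit.
Unset Printing Implicit Defensive.

Import GRing.Theory.
Local Open Scope fset_scope.
Local Open Scope ring_scope.

(** * Monomials and evaluation *)

Section Monomials.
Variable I : choiceType.
Implicit Types (m A B : mon I) (s : seq I).

(** [V] may have infinite dimension and the forms infinitely many terms, so the usual
    Nullstellensatz does not apply directly and integrality is proved by hand. It is carried by a
    matrix over B having F(v) as an eigenvalue at every common zero v. Passing from v to v + t u and
    reducing powers of t modulo g(v + t u) enlarges the matrix; F(v + t u) is brought back to F(v)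
    because their difference has coefficients of degree < d, which lie in A. The characteristic
    polynomial is formed only when no condition on v is left. The start is trivial: where F
    vanishes, the zero matrix serves. Elimination ends because it trades a form of top degree for
    forms of lower degree. In characteristic p an algebraic relation yields only a p-power of F.
    Closure under p-th roots must therefore survive each adjunction of a form, and this is where
    most of the algebra goes. Strength enters through the degree d part of A + span(h): it consists
    of combinations of the h plus finite sums of products of forms of lower positive degree. *)

Lemma big_finsupp_widen (R : Type) (idx : R) (op : Monoid.com_law idx)
    (m : mon I) (s : seq I) (F : I -> R) :
  uniq s -> {subset finsupp m <= s} ->
  (forall i, m i = 0%N -> F i = idx) ->
  \big[op/idx]_(i <- finsupp m) F i = \big[op/idx]_(i <- s) F i.
Proof.
move=> us sub F0; rewrite [RHS](bigID (fun i => i \in finsupp m)) /=.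
rewrite [X in op _ X]big1 ?Monoid.mulm1 => [|i]; last by move/fsfun_dflt/F0.
rewrite -[RHS]big_filter; apply: perm_big; apply: uniq_perm => [||i].
- exact: fset_uniq.
- exact: filter_uniq.
by rewrite mem_filter; case: (boolP (i \in finsupp m)) => // /sub ->.
Qed.

Lemma mdeg_widen m s : uniq s -> {subset finsupp m <= s} ->
  mdeg m = (\sum_(i <- s) m i)%N.
Proof. by move=> us sub; apply: big_finsupp_widen. Qed.

Lemma finsupp_msetD A B : finsupp (A `+` B)%mset = finsupp A `|` finsupp B.
Proof. by apply/fsetP => i; rewrite in_fsetU !mem_finsupp msetE2 addn_eq0 negb_and. Qed.

Lemma mdegD A B : mdeg (A `+` B)%mset = (mdeg A + mdeg B)%N.
Proof.
have us := fset_uniq (finsupp A `|` finsupp B).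
rewrite (@mdeg_widen (A `+` B)%mset _ us); last by move=> i; rewrite finsupp_msetD.
rewrite (@mdeg_widen A _ us); last by move=> i; rewrite in_fsetU => ->.
rewrite (@mdeg_widen B _ us); last by move=> i; rewrite in_fsetU => ->; rewrite orbT.
by rewrite -big_split; apply: eq_bigr => i _; rewrite msetE2.
Qed.

Lemma mdeg0 : mdeg (mset0 : mon I) = 0%N.
Proof. by rewrite /mdeg big1 // => i _; rewrite mset0E. Qed.

Lemma leq_mdeg A i : (A i <= mdeg A)%N.
Proof.
have [Ai|nAi] := boolP (i \in finsupp A); last by rewrite fsfun_dflt.
by rewrite /mdeg (big_rem i) //= leq_addr.
Qed.

Lemma submsetsP s m A : uniq s ->
  reflect ({subset finsupp A <= s} /\ forall i, i \in s -> (A i <= m i)%N)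
          (A \in submsets s m).
Proof.
elim: s A => [|i s IH] A.
  move=> _; rewrite inE; apply: (iffP eqP) => [->|[sub _]].
    by split=> // i; rewrite mem_finsupp mset0E.
  apply/msetP => i; rewrite mset0E; have := sub i.
  by rewrite mem_finsupp; case: eqP => // _ /(_ isT).
rewrite cons_uniq => /andP[nis us].
change (submsets (i :: s) m) with
  [seq (msetn j i `+` A')%mset | j <- iota 0 (m i).+1, A' <- submsets s m].
apply: (iffP idP) => [/allpairsPdep[j [A' [+ /IH[]//]]]|[sub le]].
  rewrite mem_iota add0n ltnS => lej sub' le' ->; split=> [l|l].
    rewrite finsupp_msetD in_fsetU finsupp_msetn inE => /orP[|/sub' ->]; last by rewrite orbT.
    by case: ifP => _; rewrite inE // => ->.
  rewrite inE msetE2 msetnE; case: eqP => [-> _|_ /= /le' //].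
  have A'i : A' i = 0%N by apply: fsfun_dflt; apply: contra nis; apply: sub'.
  by rewrite A'i addn0.
apply/allpairsPdep; exists (A i), (A `\` msetn (A i) i)%mset; split.
- by rewrite mem_iota add0n ltnS le ?mem_head.
- apply/IH => //; split=> l.
    rewrite mem_finsupp msetE2 msetnE; have [->|nli] := eqVneq l i; first by rewrite subnn.
    by rewrite subn0 => Al; have := sub l; rewrite mem_finsupp Al inE (negPf nli) => /(_ isT).
  move=> ls; rewrite msetE2 msetnE; have [->|nli] := eqVneq l i; first by rewrite subnn.
  by rewrite subn0 le // inE ls orbT.
- apply/msetP => l; rewrite !msetE2 msetnE; have [->|nli] := eqVneq l i; first by rewrite subnn addn0.
  by rewrite subn0.
Qed.

Lemma submsets_uniq s m : uniq s -> uniq (submsets s m).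
Proof.
elim: s => // i s IH; rewrite cons_uniq => /andP[nis us].
apply: (@allpairs_uniq _ _ _ (fun j A => msetn j i `+` A)%mset) => //; first exact: iota_uniq.
  exact: IH.
move=> [j A] [j' A'] /allpairsP[x [_ xs xE]] /allpairsP[x' [_ xs' xE']].
have {x xs xE} As : A \in submsets s m by case: xE xs => _ ->.
have {x' xs' xE'} As' : A' \in submsets s m by case: xE' xs' => _ ->.
have b0 x : x \in submsets s m -> x i = 0%N.
  by move/(submsetsP _ _ us) => [sub _]; apply: fsfun_dflt; apply: contra nis; apply: sub.
move=> /= /msetP eq; have := eq i; rewrite !msetE2 !msetnxx !b0 // !addn0 => eqj.
congr pair => //; apply/msetP => l; have := eq l.
by rewrite !msetE2 eqj => /addnI.
Qed.

Lemma monosP s n A : uniq s ->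
  reflect ({subset finsupp A <= s} /\ mdeg A = n) (A \in monos s n).
Proof.
move=> us; rewrite mem_filter.
have fE i : i \in s -> foldr (fun i M => msetn n i `+` M)%mset mset0 s i = n.
  elim: s us => //= l s IH /andP[nls us]; rewrite inE msetE2 msetnE.
  have [->|nil] //= := eqVneq i l; last exact: IH.
  suff -> : foldr (fun i M => msetn n i `+` M)%mset mset0 s l = 0%N by rewrite addn0.
  elim: s nls {IH us} => [|a s IH]; first by rewrite mset0E.
  by rewrite inE negb_or => /andP[/negPf nla /IH /=]; rewrite msetE2 msetnE nla => ->.
apply: (iffP andP) => [[/eqP dA /(submsetsP _ _ us)[]]//|[sub dA]].
rewrite dA eqxx; split=> //; apply/submsetsP => //; split=> // i /fE ->.
by rewrite -dA leq_mdeg.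
Qed.

Lemma monos_uniq s n : uniq s -> uniq (monos s n).
Proof. by move=> us; apply/filter_uniq/submsets_uniq. Qed.

Variable k : closedFieldType.
Implicit Types (u v w : vect k I).

Lemma mon_eval_widen m s v : uniq s -> {subset finsupp m <= s} ->
  mon_eval m v = \prod_(i <- s) v i ^+ m i.
Proof.
by move=> us sub; apply: big_finsupp_widen => // i ->; rewrite expr0.
Qed.

Lemma mon_evalD A B v : mon_eval (A `+` B)%mset v = mon_eval A v * mon_eval B v.
Proof.
have us := fset_uniq (finsupp A `|` finsupp B).
rewrite (@mon_eval_widen (A `+` B)%mset _ _ us); last by move=> i; rewrite finsupp_msetD.
rewrite (@mon_eval_widen A _ _ us); last by move=> i; rewrite in_fsetU => ->.
rewrite (@mon_eval_widen B _ _ us); last by move=> i; rewrite in_fsetU => ->; rewrite orbT.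
by rewrite -big_split; apply: eq_bigr => i _; rewrite msetE2 exprD.
Qed.

Lemma mon_eval0 v : mon_eval (mset0 : mon I) v = 1.
Proof. by rewrite /mon_eval big1 // => i _; rewrite mset0E. Qed.

Lemma mon_eval_eq0 m v : ~~ (finsupp m `<=` finsupp v) -> mon_eval m v = 0.
Proof.
case/fsubsetPn => i im niv; rewrite /mon_eval (big_rem i) //= (fsfun_dflt niv).
by rewrite expr0n; move: im; rewrite mem_finsupp => /negPf ->; rewrite mul0r.
Qed.

(** The point [v + t u]. Scaling is written [vlin vzero t v], so that rays through the origin are
    special lines. *)
Definition vlin (v : vect k I) (t : k) (u : vect k I) : vect k I :=
  [fsfun i in finsupp v `|` finsupp u => v i + t * u i].

Definition vzero : vect k I := [fsfun].

Lemma vlinE v t u i : vlin v t u i = v i + t * u i.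
Proof.
rewrite fsfunE in_fsetU; case: ifP => // /norP[nv nu].
by rewrite (fsfun_dflt nv) (fsfun_dflt nu) mulr0 addr0.
Qed.

Lemma vzeroE i : vzero i = 0. Proof. by rewrite fsfunE. Qed.

Lemma vlin0 v u : vlin v 0 u = v.
Proof. by apply/fsfunP => i; rewrite vlinE mul0r addr0. Qed.

Lemma vlin_zero1 v : vlin vzero 1 v = v.
Proof. by apply/fsfunP => i; rewrite vlinE vzeroE mul1r add0r. Qed.

Lemma vlin_zero0 v : vlin vzero 0 v = vzero.
Proof. exact: vlin0. Qed.

Lemma finsupp_vlin v t u : finsupp (vlin v t u) `<=` finsupp v `|` finsupp u.
Proof.
apply/fsubsetP => i; rewrite in_fsetU !mem_finsupp vlinE; apply: contraR.
by rewrite negb_or !negbK => /andP[/eqP -> /eqP ->]; rewrite mulr0 addr0.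
Qed.

Lemma mon_eval_scale m t v :
  mon_eval m (vlin vzero t v) = t ^+ mdeg m * mon_eval m v.
Proof.
rewrite /mon_eval /mdeg -prodrXr -big_split /=.
by apply: eq_bigr => i _; rewrite vlinE vzeroE add0r exprMn.
Qed.

Lemma poly_fun_inj (p q : {poly k}) : (forall t, p.[t] = q.[t]) -> p = q.
Proof.
move=> pq; apply/eqP; rewrite -subr_eq0; apply/negP => /negP /closed_nonrootP[x].
by rewrite /root hornerD hornerN pq subrr eqxx.
Qed.

(* The lists are separated by the exponents of the variables in [s]; the induction
   removes one variable, seen as the indeterminate of a univariate polynomial. *)
Lemma mon_indep (s : seq I) (l : seq (mon I)) (c : mon I -> k) :
  uniq s -> uniq l ->
  {in l &, forall A B, (forall i, i \in s -> A i = B i) -> A = B} ->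
  (forall w : I -> k, \sum_(m <- l) c m * \prod_(i <- s) w i ^+ m i = 0) ->
  {in l, forall m, c m = 0}.
Proof.
elim: s l => [|i s IH] l /=.
  move=> _ ul sep sum0 m ml; have := sum0 (fun=> 0).
  rewrite (big_rem m) //= big_nil mulr1 big1_seq ?addr0 // => m' /=.
  rewrite (mem_rem_uniq _ ul) inE => /andP[nmm' m'l].
  by case/eqP: nmm'; apply: sep.
case/andP=> nis us ul sep sum0 m ml.
pose lj := filter (fun m' : mon I => m' i == (m : mon I) i) l.
have mlj : m \in lj by rewrite mem_filter eqxx.
apply: (IH lj) mlj => //; first exact: filter_uniq.
  move=> A B; rewrite !mem_filter => /andP[/eqP Ai Al] /andP[/eqP Bi Bl] eqs.
  by apply: sep => // x; rewrite inE => /orP[/eqP ->|/eqs //]; rewrite Ai Bi.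
move=> w.
pose F m' := c m' * \prod_(x <- s) w x ^+ m' x.
pose p : {poly k} := \sum_(m' <- l) F m' *: 'X^(m' i).
have p0 : p = 0.
  apply: poly_fun_inj => t; rewrite horner0 -[RHS](sum0 (fun x => if x == i then t else w x)).
  rewrite horner_sum; apply: eq_bigr => m' _.
  rewrite hornerZ hornerXn big_cons eqxx /F -mulrA; congr (_ * _).
  rewrite mulrC; congr (_ * _); apply: eq_big_seq => x xs.
  by case: eqP => // xi; rewrite -xi xs in nis.
have e : p`_((m : mon I) i) = 0 by rewrite p0 coef0.
rewrite -[RHS]e coef_sum big_filter big_mkcond.
apply: eq_bigr => m' _; rewrite coefZ coefXn eq_sym.
by case: eqP => _; rewrite ?mulr1 ?mulr0.
Qed.

Lemma mon_eval_indep (s : {fset I}) (n : nat) (c : mon I -> k) :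
  (forall v, finsupp v `<=` s -> \sum_(m <- monos s n) c m * mon_eval m v = 0) ->
  {in monos s n, forall m, c m = 0}.
Proof.
have us := fset_uniq s.
move=> sum0; apply: (@mon_indep s) => //; first exact: monos_uniq.
  move=> A B /(monosP _ _ us)[subA _] /(monosP _ _ us)[subB _] eqs.
  apply/msetP => i; have [/eqs //|nis] := boolP (i \in s).
  by rewrite !fsfun_dflt //; apply: contra nis; [apply: subB|apply: subA].
move=> w; pose v : vect k I := [fsfun i in s => w i].
have sv : finsupp v `<=` s.
  by apply/fsubsetP => i; rewrite mem_finsupp fsfunE; case: ifP => //; rewrite eqxx.
rewrite -[RHS](sum0 v sv); apply: eq_big_seq => m /(monosP _ _ us)[sub _].
rewrite (mon_eval_widen _ us sub); congr (_ * _).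
by apply: eq_big_seq => i ins; rewrite fsfunE ins.
Qed.

Lemma peval_widen (s : seq I) (n : nat) (f : series k I) v :
  uniq s -> {subset finsupp v <= s} ->
  peval n f v = \sum_(m <- monos s n) f m * mon_eval m v.
Proof.
move=> us sub; rewrite [RHS](bigID (fun m => finsupp m `<=` finsupp v)) /=.
rewrite [X in _ + X]big1 ?addr0 => [|m]; last by move/mon_eval_eq0 ->; rewrite mulr0.
rewrite -[RHS]big_filter; apply: perm_big; apply: uniq_perm => [||m].
- exact/monos_uniq/fset_uniq.
- exact/filter_uniq/monos_uniq.
have uv := fset_uniq (finsupp v).
rewrite [RHS]mem_filter; apply/idP/idP => [/(monosP _ _ uv)[subm dm]|].
  apply/andP; split; first exact/fsubsetP.
  by apply/monosP => //; split=> // i /subm /sub.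
by case/andP=> /fsubsetP subm /(monosP _ _ us)[_ dm]; apply/monosP.
Qed.

(** A monomial [m] involves finitely many coordinates: on vectors supported there the evaluations
    are finite sums, and independence of monomials compares the coefficients of [m]. *)
Lemma peval_inj (n : nat) (f g : series k I) :
  homog n f -> homog n g -> (forall v, peval n f v = peval n g v) -> f = g.
Proof.
move=> hf hg eq; apply: functional_extensionality => m; apply/eqP; rewrite -subr_eq0.
have [dm|dm] := eqVneq (mdeg m) n; last first.
  have f0 : f m = 0 by apply/eqP; apply: contraR dm => /hf ->.
  have g0 : g m = 0 by apply/eqP; apply: contraR dm => /hg ->.
  by rewrite f0 g0 subrr.
have us := fset_uniq (finsupp m).
apply/eqP; apply: (@mon_eval_indep (finsupp m) n (fun m => f m - g m)); last by apply/(monosP _ _ us); split.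
move=> v /fsubsetP sv; apply/eqP; under eq_bigr do rewrite mulrBl.
by rewrite sumrB -!peval_widen // eq subrr.
Qed.

Lemma submsetKD m A : (forall i, (A i <= m i)%N) -> (A `+` (m `\` A))%mset = m.
Proof. by move=> le; apply/msetP => i; rewrite !msetE2 subnKC. Qed.

Lemma submsets_finsuppP m A :
  reflect (forall i, (A i <= m i)%N) (A \in submsets (finsupp m) m).
Proof.
apply: (iffP (submsetsP m A (fset_uniq (finsupp m)))) => [[sub le] i|le].
  have [/le //|nim] := boolP (i \in finsupp m).
  by rewrite fsfun_dflt //; apply: contra nim; apply: sub.
split=> // i; rewrite !mem_finsupp -!lt0n => Ai; exact: leq_trans (le i).
Qed.

Lemma homog_smul (a b : nat) (g h : series k I) :
  homog a g -> homog b h -> homog (a + b) (smul g h).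
Proof.
move=> hg hh m; apply: contraNeq => dm; apply/eqP; apply: big1_seq => A /= /submsets_finsuppP le.
have [->|/hg dA] := eqVneq (g A) 0; first by rewrite mul0r.
have [->|/hh dB] := eqVneq (h (m `\` A)%mset) 0; first by rewrite mulr0.
by case/eqP: dm; rewrite -dA -dB -mdegD submsetKD.
Qed.

(** Both sides are sums over pairs of monomials [A], [B]. The left side groups them by the product
    [m]; given [m], the factor [A] determines the cofactor [B]. *)
Lemma peval_smul (a b : nat) (g h : series k I) v :
  homog a g -> homog b h -> peval (a + b) (smul g h) v = peval a g v * peval b h v.
Proof.
move=> hg hh; have us := fset_uniq (finsupp v).
rewrite /peval /smul; set s := finsupp v in us *.
under eq_bigr do rewrite big_distrl /=.
rewrite big_distrl /=; under [RHS]eq_bigr do rewrite big_distrr /=.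
pose G A B := (g A * mon_eval A v) * (h B * mon_eval B v).
have inner A m : A \in monos s a -> m \in monos s (a + b) ->
   \sum_(B <- monos s b | (A `+` B)%mset == m) G A B =
   if A \in submsets (finsupp m) m then g A * h (m `\` A)%mset * mon_eval m v else 0.
  move=> /(monosP _ _ us)[sA dA] /(monosP _ _ us)[sm dm].
  case: submsets_finsuppP => [le|nle]; last first.
    rewrite big1 // => B /eqP mE; case: nle => i; by rewrite -mE msetE2 leq_addr.
  have mE := submsetKD le.
  have Bs : (m `\` A)%mset \in monos s b.
    apply/monosP => //; split.
      by move=> i; rewrite mem_finsupp msetE2 => nz; apply: sm; rewrite mem_finsupp;
         apply: contra nz => /eqP ->.
    by apply: (@addnI a); rewrite -[in LHS]dA -mdegD mE.
  rewrite big_mkcond (bigD1_seq (m `\` A)%mset) ?monos_uniq //= mE eqxx.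
  rewrite big1 ?addr0 => [|B nB]; last first.
    by case: eqP => // BE; case/eqP: nB; rewrite -BE msetDKB.
  by rewrite /G -[in mon_eval m v]mE mon_evalD mulrACA.
transitivity (\sum_(A <- monos s a) \sum_(m <- monos s (a + b))
    \sum_(B <- monos s b | (A `+` B)%mset == m) G A B); last first.
  apply: eq_big_seq => A Aa; under [LHS]eq_bigr do rewrite big_mkcond.
  rewrite exchange_big /=; apply: eq_big_seq => B Bb.
  have ABs : (A `+` B)%mset \in monos s (a + b).
    case/(monosP _ _ us): Aa => sA dA; case/(monosP _ _ us): Bb => sB dB.
    apply/monosP => //; split; last by rewrite mdegD dA dB.
    by move=> i; rewrite finsupp_msetD in_fsetU => /orP[/sA|/sB].
  rewrite (bigD1_seq (A `+` B)%mset) ?monos_uniq //= eqxx big1 ?addr0 // => m.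
  by rewrite eq_sym => /negPf ->.
rewrite [RHS]exchange_big /=; apply: eq_big_seq => m mab.
under [RHS]eq_big_seq => A Aa do rewrite inner //.
rewrite -big_mkcond -[RHS]big_filter (bigID (mem (monos s a))) /=.
(* Submonomials of [m] whose degree is not [a] contribute nothing, because [g] vanishes on them. *)
rewrite [X in _ + X]big1_seq ?addr0 => [|A /andP[nA As]]; last first.
  have [->|/hg dA] := eqVneq (g A) 0; first by rewrite !mul0r.
  case/negP: nA; apply/monosP => //; split=> // i.
  case/(monosP _ _ us): mab => sm _; move/submsets_finsuppP: As => le.
  by rewrite mem_finsupp -lt0n => Ai; apply: sm; rewrite mem_finsupp -lt0n (leq_trans Ai).
rewrite -[LHS]big_filter; apply: perm_big; apply: uniq_perm => [||A].
- exact/filter_uniq/submsets_uniq/fset_uniq.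
- exact/filter_uniq/monos_uniq.
by rewrite [LHS]mem_filter [RHS]mem_filter andbC.
Qed.

End Monomials.

(** * Polynomial functions *)

Lemma fun_choice (A T : Type) (P : A -> T -> Prop) :
  (forall x, exists y, P x y) -> exists f, forall x, P x (f x).
Proof.
move=> ex; exists (fun x => proj1_sig (constructive_indefinite_description _ (ex x))).
by move=> x; case: constructive_indefinite_description.
Qed.

Section PolynomialFunctions.
Variables (k : closedFieldType) (I : choiceType).
Local Notation V := (vect k I).
Local Notation fn := (V -> k).
Local Notation v0 := (vzero I k).
Implicit Types (u v : V) (f g h y : fn).

(* P_n(V), as functions on V; the monomials may depend on the finite set of coordinates
   considered, which is harmless because k is infinite (lemma [Pn_series]). *)
Definition Pn (n : nat) (f : fn) : Prop :=
  forall s : {fset I}, exists l : seq (k * mon I),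
    all (fun x => mdeg x.2 == n) l /\
    forall v, finsupp v `<=` s -> f v = \sum_(x <- l) x.1 * mon_eval x.2 v.

Lemma Pn_zero n : Pn n (fun=> 0).
Proof. by move=> s; exists [::]; split=> // v _; rewrite big_nil. Qed.

Lemma PnD n f g : Pn n f -> Pn n g -> Pn n (fun v => f v + g v).
Proof.
move=> Pf Pg s; have [l [al lE]] := Pf s; have [l' [al' lE']] := Pg s.
exists (l ++ l'); split; first by rewrite all_cat al.
by move=> v sv; rewrite lE // lE' // big_cat.
Qed.

Lemma PnM a b f g : Pn a f -> Pn b g -> Pn (a + b) (fun v => f v * g v).
Proof.
move=> Pf Pg s; have [l [al lE]] := Pf s; have [l' [al' lE']] := Pg s.
exists [seq (x.1 * x'.1, (x.2 `+` x'.2)%mset) | x <- l, x' <- l']; split.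
  apply/allP => _ /allpairsP[[x x'] /= [xl xl' ->]] /=.
  by rewrite mdegD (eqP (allP al _ xl)) (eqP (allP al' _ xl')).
move=> v sv; rewrite lE // lE' // big_allpairs_dep big_distrl /=.
apply: eq_bigr => x _; rewrite big_distrr /=; apply: eq_bigr => x' _.
by rewrite mon_evalD mulrACA.
Qed.

Lemma PnC c : Pn 0 (fun=> c).
Proof.
move=> s; exists [:: (c, mset0)]; split=> [|v _]; first by rewrite /= mdeg0.
by rewrite big_seq1 mon_eval0 mulr1.
Qed.

Lemma PnZ n c f : Pn n f -> Pn n (fun v => c * f v).
Proof. by move=> Pf; rewrite -[n]add0n; apply: PnM => //; apply: PnC. Qed.

Lemma PnX a n f : Pn a f -> Pn (a * n) (fun v => f v ^+ n).
Proof.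
move=> Pf; elim: n => [|n IH]; first by rewrite muln0; apply: PnC.
rewrite mulnS; have := PnM Pf IH; congr Pn.
by apply: functional_extensionality => v; rewrite exprS.
Qed.

Lemma Pn_sum n (T : Type) (l : seq T) (F : T -> fn) (P : pred T) :
  (forall x, P x -> Pn n (F x)) -> Pn n (fun v => \sum_(x <- l | P x) F x v).
Proof.
move=> PF; elim: l => [|x l IH].
  by under [X in Pn _ X]functional_extensionality do rewrite big_nil; apply: Pn_zero.
under [X in Pn _ X]functional_extensionality do rewrite big_cons.
case Px: (P x) => //; exact: PnD (PF x Px) IH.
Qed.

Lemma Pn_scale n f t v : Pn n f -> f (vlin v0 t v) = t ^+ n * f v.
Proof.
case/(_ (finsupp v)) => l [al lE]; rewrite !lE //; last first.
  by apply: fsubset_trans (finsupp_vlin _ _ _) _; rewrite finsupp0 fset0U.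
rewrite big_distrr; apply: eq_big_seq => x /(allP al)/eqP dx.
by rewrite mon_eval_scale dx mulrCA.
Qed.

Lemma Pn_at0 n f : Pn n f -> (0 < n)%N -> f v0 = 0.
Proof.
by move=> Pf n0; rewrite -(vlin_zero0 v0) (Pn_scale _ _ Pf) expr0n gtn_eqF // mul0r.
Qed.

Lemma Pn0_const f v : Pn 0 f -> f v = f v0.
Proof. by move=> Pf; rewrite -[in RHS](vlin_zero0 v) (Pn_scale _ _ Pf) mul1r. Qed.

Lemma Pn_peval n (s : series k I) : Pn n (peval n s).
Proof.
move=> S; have us := fset_uniq S.
exists [seq (s m, m) | m <- monos S n]; split.
  by apply/allP => _ /mapP[m /(monosP _ _ us)[_ dm] ->]; apply/eqP.
by move=> v /fsubsetP sv; rewrite (peval_widen _ _ us sv) big_map.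
Qed.

Lemma Pn_local n f (s : {fset I}) : Pn n f ->
  exists c : series k I, homog n c /\
    forall v, finsupp v `<=` s -> f v = \sum_(m <- monos s n) c m * mon_eval m v.
Proof.
case/(_ s) => l [al lE]; have us := fset_uniq s.
exists (fun m => \sum_(x <- l | x.2 == m) x.1); split=> [m|v sv].
  apply: contraNeq => dm; rewrite big1_seq // => x /andP[/eqP xm /(allP al)].
  by rewrite xm (negPf dm).
under eq_bigr do rewrite big_distrl /= big_mkcond.
rewrite exchange_big lE //; apply: eq_big_seq => x xl /=.
rewrite -big_mkcond (eq_bigr (fun=> x.1 * mon_eval x.2 v)) => [|m /eqP <- //].
have [sx|nsx] := boolP (finsupp x.2 `<=` finsupp v); last first.
  by rewrite mon_eval_eq0 // mulr0 big1.
have xs : x.2 \in monos s n.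
  apply/monosP => //; split; last exact/eqP/(allP al).
  exact/fsubsetP/(fsubset_trans sx).
rewrite big_mkcond (bigD1_seq x.2) ?monos_uniq //= eqxx big1 ?addr0 // => m.
by rewrite eq_sym => /negPf ->.
Qed.

(** The coefficient of [m] is read off on the variables of [m]. By independence of monomials every
    larger set of coordinates gives the same value, so the local expansions glue to one series. *)
Lemma Pn_series n f : Pn n f -> exists c, homog n c /\ f = peval n c.
Proof.
move=> Pf.
have [C CP] := fun_choice (fun s => Pn_local s Pf).
exists (fun m => C (finsupp m) m); split=> [m|]; first exact: (CP _).1.
apply: functional_extensionality => v; rewrite (CP (finsupp v)).2 //.
apply: eq_big_seq => m /(monosP _ _ (fset_uniq _))[sm dm]; congr (_ * _).
have us := fset_uniq (finsupp m).
apply/eqP; rewrite -subr_eq0; apply/eqP.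
apply: (@mon_eval_indep _ _ (finsupp m) n (fun m' => C (finsupp v) m' - C (finsupp m) m')).
  move=> w sw; under eq_bigr do rewrite mulrBl.
  have svw : finsupp w `<=` finsupp v by apply: fsubset_trans sw _; apply/fsubsetP.
  rewrite sumrB -(CP (finsupp m)).2 // -(@peval_widen _ _ _ _ _ _ us); last exact/fsubsetP.
  rewrite (@peval_widen _ _ _ _ _ _ (fset_uniq (finsupp v))); last exact/fsubsetP.
  by rewrite -(CP (finsupp v)).2 // subrr.
by apply/(monosP _ _ us); split.
Qed.

Lemma Pn_coord i : Pn 1 (fun v => v i).
Proof.
move=> s; exists [:: (1, msetn 1 i)]; have supp : finsupp (msetn 1 i) = [fset i] by rewrite finsupp_msetn.
split=> [|v _].
  by rewrite /= /mdeg supp big_seq_fset1 msetnxx.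
by rewrite big_seq1 mul1r /mon_eval supp big_seq_fset1 msetnxx expr1.
Qed.

(* Junk value unless the function is polynomial. *)
Definition interp (F : k -> k) : {poly k} :=
  epsilon (inhabits 0) (fun p => forall t, F t = p.[t]).

Lemma interpE (F : k -> k) p : (forall t, F t = p.[t]) -> interp F = p.
Proof.
move=> FE; apply: poly_fun_inj => t; rewrite -FE.
by rewrite -(epsilon_spec (inhabits 0) (fun p => forall t, F t = p.[t])) //; exists p.
Qed.

(** The coefficients are the Hasse derivatives of [f] at [v] along [u]; they make sense in every
    characteristic, and the coefficient of index 1 is the ordinary derivative. *)
Definition line_poly u f v := interp (fun t => f (vlin v t u)).
Definition ray_poly f v := interp (fun t => f (vlin v0 t v)).

(** Homogeneity of total degree [n] in [v] and the line parameter together. *)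
Definition line_homog n (q : V -> {poly k}) : Prop :=
  (forall j, (j <= n)%N -> Pn (n - j) (fun v => (q v)`_j)) /\
  (forall j v, (n < j)%N -> (q v)`_j = 0).

Lemma line_homog_mul a b q r : line_homog a q -> line_homog b r -> line_homog (a + b) (fun v => q v * r v).
Proof.
move=> [qP q0] [rP r0]; split=> [j lej|j v ltj].
  under [X in Pn _ X]functional_extensionality do rewrite coefM.
  apply: Pn_sum => i _; have ij : (i <= j)%N by rewrite -ltnS.
  have [ia|ai] := leqP i a; last first.
    by under [X in Pn _ X]functional_extensionality do rewrite q0 // mul0r; apply: Pn_zero.
  have [jb|bj] := leqP (j - i) b; last first.
    by under [X in Pn _ X]functional_extensionality do rewrite r0 // mulr0; apply: Pn_zero.
  have -> : (a + b - j = (a - i) + (b - (j - i)))%N.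
    rewrite -{1}(subnKC ij) subnDA -addnBAC // addnBA //.
  by apply: PnM; [apply: qP|apply: rP].
rewrite coefM big1 // => i _; have ij : (i <= j)%N by rewrite -ltnS.
have [ia|ai] := leqP i a; last by rewrite q0 ?mul0r.
rewrite r0 ?mulr0 // ltn_subRL; apply: leq_ltn_trans ltj; by rewrite leq_add2r.
Qed.

Lemma line_homog_one : line_homog 0 (fun=> 1).
Proof.
split=> [j|j v j0]; last by rewrite coef1 gtn_eqF.
rewrite leqn0 => /eqP ->; under [X in Pn _ X]functional_extensionality do rewrite coef1.
exact: PnC.
Qed.

Lemma line_homog_exp a n q : line_homog a q -> line_homog (n * a) (fun v => q v ^+ n).
Proof.
move=> Lq; elim: n => [|n IH]; first exact: line_homog_one.
by under [X in line_homog _ X]functional_extensionality do rewrite exprS; apply: line_homog_mul.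
Qed.

Lemma line_homog_lin u i : line_homog 1 (fun v => (v i)%:P + u i *: 'X).
Proof.
split=> [j|j v lej].
  case: j => [|[|//]] _ /=.
    under [X in Pn _ X]functional_extensionality do rewrite coefD coefC coefZ coefX mulr0 addr0.
    exact: Pn_coord.
  under [X in Pn _ X]functional_extensionality do rewrite coefD coefC coefZ coefX mulr1 add0r.
  exact: PnC.
by rewrite coefD coefC coefZ coefX gtn_eqF ?(ltn_trans _ lej) // gtn_eqF // mulr0 addr0.
Qed.

Definition mon_shift (u : V) (m : mon I) (v : V) : {poly k} :=
  \prod_(i <- finsupp m) ((v i)%:P + u i *: 'X) ^+ m i.

Lemma line_homog_mon_shift u m : line_homog (mdeg m) (mon_shift u m).
Proof.
rewrite /mon_shift /mdeg; elim: (enum_fset (finsupp m)) => [|i l IH].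
  under [X in line_homog _ X]functional_extensionality do rewrite big_nil.
  by rewrite big_nil; apply: line_homog_one.
under [X in line_homog _ X]functional_extensionality do rewrite big_cons.
rewrite big_cons; apply: line_homog_mul IH; rewrite -[X in line_homog X]muln1.
exact/line_homog_exp/line_homog_lin.
Qed.

Lemma mon_shiftE u m v t : (mon_shift u m v).[t] = mon_eval m (vlin v t u).
Proof.
rewrite /mon_shift /mon_eval horner_prod; apply: eq_bigr => i _.
by rewrite horner_exp !hornerE vlinE [u i * t]mulrC.
Qed.

Lemma line_poly_local n f u (s : {fset I}) : Pn n f ->
  exists l : seq (k * mon I), all (fun x => mdeg x.2 == n) l /\
    forall v, finsupp v `<=` s ->
      line_poly u f v = \sum_(x <- l) x.1 *: mon_shift u x.2 v /\
      forall t, f (vlin v t u) = (line_poly u f v).[t].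
Proof.
case/(_ (s `|` finsupp u)) => l [al lE]; exists l; split=> // v sv.
have fE t : f (vlin v t u) = (\sum_(x <- l) x.1 *: mon_shift u x.2 v).[t].
  rewrite horner_sum lE.
    by apply: eq_bigr => x _; rewrite hornerZ mon_shiftE.
  by apply: fsubset_trans (finsupp_vlin _ _ _) _; apply: fsetSU.
have E := interpE fE; split; first exact: E.
by move=> t; rewrite /line_poly E.
Qed.

Lemma line_polyE n f u v t : Pn n f -> f (vlin v t u) = (line_poly u f v).[t].
Proof.
by move=> /(line_poly_local u (finsupp v))[l [_ /(_ v (fsubset_refl _))[_]]].
Qed.

Lemma line_homog_line_poly n f u : Pn n f -> line_homog n (line_poly u f).
Proof.
move=> Pf; split=> [j jn|j v nj]; last first.
  have [l [al /(_ v (fsubset_refl _))[-> _]]] := line_poly_local u (finsupp v) Pf.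
  rewrite coef_sum big1_seq // => x /= /(allP al)/eqP dx; rewrite coefZ.
  by rewrite (line_homog_mon_shift u x.2).2 ?dx // mulr0.
move=> s; have [l [al lE]] := line_poly_local u s Pf.
have : Pn (n - j) (fun v => \sum_(x <- l | mdeg x.2 == n) x.1 * (mon_shift u x.2 v)`_j).
  by apply: Pn_sum => x /eqP dx; apply/PnZ; rewrite -dx; apply: (line_homog_mon_shift u x.2).1; rewrite dx.
case/(_ s) => l' [al' lE']; exists l'; split=> // v sv.
rewrite -lE' // (lE v sv).1 coef_sum big_seq_cond [RHS]big_seq_cond.
apply: eq_big => [x|x _]; last by rewrite coefZ.
by case xl: (x \in l) => //=; rewrite (allP al _ xl).
Qed.

Lemma line_poly_coef0 n f u v : Pn n f -> (line_poly u f v)`_0 = f v.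
Proof. by move=> Pf; rewrite -horner_coef0 -(line_polyE _ _ _ Pf) vlin0. Qed.

Lemma ray_poly_Pn n f v : Pn n f -> ray_poly f v = f v *: 'X^n.
Proof.
by move=> Pf; apply: interpE => t; rewrite (Pn_scale _ _ Pf) hornerZ hornerXn mulrC.
Qed.

(** The top coefficient is a form of degree 0 in [v], hence constant, and at the origin the line is
    the ray through [u]. *)
Lemma line_poly_coefn n f u v : Pn n f -> (line_poly u f v)`_n = f u.
Proof.
move=> Pf; have := (line_homog_line_poly u Pf).1 n (leqnn n); rewrite subnn => /(Pn0_const v) ->.
have <- : ray_poly f u = line_poly u f v0 by [].
by rewrite (ray_poly_Pn _ Pf) coefZ coefXn eqxx mulr1.
Qed.

Lemma size_line_poly n f u v : Pn n f -> (size (line_poly u f v) <= n.+1)%N.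
Proof. by move=> Pf; apply/leq_sizeP => j nj; apply: (line_homog_line_poly u Pf).2. Qed.

Lemma exists_root n (x : k) : (0 < n)%N -> exists z, z ^+ n = x.
Proof.
move=> n0; have /closed_rootP[z] : size ('X^n - x%:P) != 1%N by rewrite size_XnsubC // eqSS -lt0n.
by rewrite /root !hornerE subr_eq0 => /eqP zE; exists z.
Qed.

(** The factor [v i] restores the exponent lowered by differentiation, so that the result is a
    multiple of the same monomial. *)
Lemma mon_shift_coef1 (i : I) (m : mon I) v :
  (mon_shift [fsfun x in [fset i] => 1] m v)`_1 * v i = (m i)%:R * mon_eval m v.
Proof.
set e : V := [fsfun x in [fset i] => 1].
have eE x : e x = (x == i)%:R by rewrite fsfunE inE; case: eqP.
have ne x : x != i -> (v x)%:P + e x *: 'X = (v x)%:P :> {poly k}.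
  by move=> /negPf xi; rewrite eE xi scale0r addr0.
pose c := \prod_(x <- rem i (finsupp m)) v x ^+ m x.
have cE : \prod_(x <- rem i (finsupp m)) ((v x)%:P + e x *: 'X) ^+ m x = c%:P.
  rewrite rmorph_prod; apply: eq_big_seq => x.
  rewrite (mem_rem_uniq _ (fset_uniq _)) inE => /andP[xi _].
  by rewrite (ne _ xi) [RHS]rmorphXn.
have [im|nim] := boolP (i \in finsupp m); last first.
  rewrite (fsfun_dflt nim) !mul0r /mon_shift -(rem_id nim) cE coefC.
  by rewrite mul0r.
rewrite /mon_shift /mon_eval !(big_rem i im) /= cE -/c eE eqxx scale1r coefMC.
have -> : (((v i)%:P + 'X) ^+ m i)`_1 * c * v i =
          (((v i)%:P + 'X) ^+ m i)`_1 * v i * c by rewrite mulrAC.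
rewrite mulrA; congr (_ * _); rewrite addrC.
elim: (m i) => [|n IH]; first by rewrite expr0 coef1 !mul0r.
rewrite exprS mulrDl coefD coefXM coefCM /= mulrDl -mulrA IH.
rewrite -horner_coef0 horner_exp !hornerE /=.
by rewrite -natr1 mulrDl mul1r -exprSr addrC [v i * _]mulrC -mulrA -exprS.
Qed.

(* All exponents in [f] are divisible by [p], because v_i times the i-th derivative
   multiplies a monomial by its i-th exponent. *)
Lemma Pn_root n p f : p \in [pchar k] -> Pn n f ->
  (forall u v, (line_poly u f v)`_1 = 0) -> exists z, Pn (n %/ p) z /\ forall v, z v ^+ p = f v.
Proof.
move=> pk Pf D0; have p0 := prime_gt0 (pcharf_prime pk).
have [rt rtE] := fun_choice (fun x => exists_root x p0).
have Finj : injective (fun x : k => x ^+ p) by exact: (fmorph_inj (pFrobenius_aut pk)).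
(* The root is chosen pointwise. Since Frobenius is injective, it agrees on each finite set of
   coordinates with the form built from roots of the coefficients and from monomials with exponents
   divided by [p]. *)
exists (fun v => rt (f v)); split=> [s|v]; last exact: rtE.
have us := fset_uniq s.
have [c [hc cE]] := Pn_local s Pf.
have c0 i m : m \in monos s n -> i \in s -> c m * (m i)%:R = 0.
  move=> ms si; apply: (@mon_eval_indep _ _ s n (fun m => c m * ((m : mon I) i)%:R)) ms => v sv.
  pose e : V := [fsfun x in [fset i] => 1].
  have := D0 e v; rewrite (_ : line_poly e f v = \sum_(m <- monos s n) c m *: mon_shift e m v).
    move=> /(congr1 (fun x => x * v i)); rewrite mul0r coef_sum big_distrl /= => D; rewrite -[RHS]D.
    by apply: eq_bigr => m' _; rewrite coefZ -!mulrA mon_shift_coef1.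
  apply: interpE => t; rewrite cE ?horner_sum.
    by apply: eq_bigr => m' _; rewrite hornerZ mon_shiftE.
  apply: fsubset_trans (finsupp_vlin _ _ _) _; rewrite fsubUset sv.
  apply/fsubsetP => x; rewrite mem_finsupp fsfunE inE.
  by have [->//|_] := eqVneq x i; rewrite eqxx.
pose md (m : mon I) : mon I := [fsfun i in finsupp m => (m i %/ p)%N].
have mdE (m : mon I) i : md m i = (m i %/ p)%N.
  by rewrite fsfunE; case: ifP => // /negbT/fsfun_dflt ->; rewrite div0n.
have smd m : {subset finsupp (md m) <= finsupp m}.
  by move=> i; rewrite !mem_finsupp mdE; apply: contra => /eqP ->; rewrite div0n.
have dvd (m : mon I) i : m \in monos s n -> c m != 0 -> (p %| m i)%N.
  move=> ms cm; have [si|nsi] := boolP (i \in s).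
    have /eqP := c0 i m ms si; rewrite mulf_eq0 (negPf cm) /=.
    by rewrite -(dvdn_pcharf pk).
  have [sm _] := monosP _ _ us ms.
  by rewrite fsfun_dflt //; apply: contra nsi; apply: sm.
exists [seq (rt (c m), md m) | m <- monos s n & c m != 0]; split.
  apply/allP => x /mapP[m]; rewrite mem_filter => /andP[cm ms] -> /=.
  have [sm dm] := monosP _ _ us ms.
  rewrite (mdeg_widen us) => [|i /smd /sm //].
  rewrite -dm (mdeg_widen us sm).
  have -> : (\sum_(i <- s) m i = (\sum_(i <- s) md m i) * p)%N.
    by rewrite big_distrl /=; apply: eq_bigr => i _; rewrite mdE divnK // dvd.
  by rewrite mulnK.
move=> v sv; apply: Finj => /=; rewrite rtE cE // big_map big_filter.
rewrite -[RHS](pFrobenius_autE pk) rmorph_sum /=.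
rewrite [LHS](bigID (fun m => c m != 0)) /= [X in _ + X]big1 ?addr0; last first.
  by move=> m; rewrite negbK => /eqP ->; rewrite mul0r.
rewrite big_seq_cond [RHS]big_seq_cond; apply: eq_bigr => m /andP[ms cm].
have [sm dm] := monosP _ _ us ms.
rewrite pFrobenius_autE exprMn rtE; congr (_ * _).
rewrite (mon_eval_widen _ us sm) (mon_eval_widen _ us); last by move=> i /smd /sm.
rewrite -prodrXl; apply: eq_bigr => i _.
by rewrite mdE -exprM divnK // dvd.
Qed.

End PolynomialFunctions.

(** * Subalgebras of functions *)

Lemma nat_min (P : nat -> Prop) :
  (exists n, P n) -> exists n, P n /\ forall m, (m < n)%N -> ~ P m.
Proof.
case=> n; elim/ltn_ind: n => n IH Pn.
have [[m [mn Pm]]|none] := classic (exists m, (m < n)%N /\ P m); first exact: IH Pm.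
by exists n; split=> // m mn Pm; apply: none; exists m.
Qed.

Section PolyFacts.
Variable k : fieldType.
Implicit Types (p q : {poly k}) (c : k).

Lemma coef_XaddC_exp c i j : (('X + c%:P) ^+ i)`_j = c ^+ (i - j) *+ 'C(i, j).
Proof.
rewrite addrC exprDn coef_sum.
have E (l : 'I_i.+1) : (c%:P ^+ (i - l) * 'X^l *+ 'C(i, l))`_j =
    if l == j :> nat then c ^+ (i - j) *+ 'C(i, j) else 0.
  rewrite coefMn -rmorphXn coefCM coefXn eq_sym.
  by case: eqP => [->|_]; rewrite ?mulr1 // mulr0 mul0rn.
under eq_bigr do rewrite E.
have [ji|ij] := leqP j i; last first.
  by rewrite bin_small // mulr0n big1 // => l _; case: eqP.
rewrite -big_mkcond (big_pred1 (Ordinal (ji : (j < i.+1)%N))) //.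
Qed.

Lemma coef_comp_XaddC p c N j : (size p <= N)%N ->
  (p \Po ('X + c%:P))`_j = \sum_(i < N) p`_i * (c ^+ (i - j) *+ 'C(i, j)).
Proof.
move=> sp; rewrite coef_comp_poly (big_ord_widen N (fun i => p`_i * (('X + c%:P) ^+ i)`_j)) //.
rewrite big_mkcond; apply: eq_bigr => i _; rewrite coef_XaddC_exp.
by case: ltnP => // sz; rewrite nth_default ?mul0r.
Qed.

Lemma coef_comp_XaddC_top p c n : (size p <= n.+1)%N -> (p \Po ('X + c%:P))`_n = p`_n.
Proof.
move=> sp; rewrite (coef_comp_XaddC _ _ sp) big_ord_recr /= subnn binn mulr1 big1 ?add0r //.
by move=> i _; rewrite bin_small ?mulr0n ?mulr0.
Qed.

(** Raising to the power [P] applies Frobenius to the coefficients and substitutes ['X^P] for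
    ['X]. *)
Lemma coef_exp_pchar (P : nat) p i : P \in [pchar k] ->
  (p ^+ P)`_i = if (P %| i)%N then p`_(i %/ P) ^+ P else 0.
Proof.
move=> Pk; have P0 := prime_gt0 (pcharf_prime Pk).
have Pk' : P \in [pchar {poly k}] by rewrite pchar_poly.
have -> : p ^+ P = map_poly (pFrobenius_aut Pk) p \Po 'X^P.
  rewrite -(pFrobenius_autE Pk') -[in LHS](coefK p) poly_def rmorph_sum /=.
  rewrite comp_polyE (size_map_poly (pFrobenius_aut Pk)); apply: eq_bigr => l _.
  by rewrite pFrobenius_autE -mul_polyC exprMn -exprM mulnC exprM coef_map /= pFrobenius_autE -mul_polyC rmorphXn.
by rewrite coef_comp_poly_Xn // coef_map.
Qed.

(** In [j * C(i, j) = i * C(i - 1, j - 1)] the prime [P] divides the right side but not [j]. *)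
Lemma bin_pchar_eq0 (P i j : nat) : P \in [pchar k] -> (P %| i)%N -> ~~ (P %| j)%N ->
  'C(i, j)%:R = 0 :> k.
Proof.
move=> Pk; have Pp := pcharf_prime Pk.
case: i => [|i] Pi Pj; first by case: j Pj => [|j]; rewrite ?dvdn0.
case: j Pj => [|j] Pj; first by rewrite dvdn0 in Pj.
apply/eqP; rewrite -(dvdn_pcharf Pk); have := mul_bin_diag i.+1 j.
move/(congr1 (dvdn P)); rewrite dvdn_mulr // (Euclid_dvdM _ _ Pp) (negPf Pj) /=.
by move=> <-.
Qed.

Lemma coef1M p q : (p * q)`_1 = p`_0 * q`_1 + p`_1 * q`_0.
Proof. by rewrite coefM big_ord_recl big_ord1. Qed.

Lemma coef1X p n : (p ^+ n)`_1 = p`_0 ^+ n.-1 * p`_1 *+ n.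
Proof.
elim: n => [|n IH]; first by rewrite expr0 coef1.
have c0 m : (p ^+ m)`_0 = p`_0 ^+ m by rewrite -!horner_coef0 horner_exp.
rewrite exprS coef1M IH c0 mulrnAr mulrA; case: n {IH} => [|n]; first by rewrite mulr0n add0r expr0 mulr1 mul1r.
by rewrite -exprS [p`_1 * _]mulrC -mulrSr.
Qed.

End PolyFacts.

Section Subalgebras.
Variables (k : closedFieldType) (I : choiceType).
Local Notation V := (vect k I).
Local Notation fn := (V -> k).
Local Notation v0 := (vzero I k).
Implicit Types (u v : V) (f g h y b : fn) (a : V -> {poly k}) (B : fn -> Prop).

Record subalg B : Prop := Subalg {
  sa_const : forall c, B (fun=> c);
  sa_add : forall f g, B f -> B g -> B (fun v => f v + g v);
  sa_mul : forall f g, B f -> B g -> B (fun v => f v * g v) }.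

(* Polynomials with coefficients in [B], as families of polynomials of bounded degree. *)
Definition coefs_in B a : Prop :=
  (exists N, forall v, (size (a v) <= N)%N) /\ forall i, B (fun v => (a v)`_i).

Lemma coefs_in_mono B B' a : (forall f, B f -> B' f) -> coefs_in B a -> coefs_in B' a.
Proof. by move=> BB' [sz Ba]; split=> // i; apply: BB'. Qed.

Section Closure.
Variable (B : fn -> Prop) (sB : subalg B).

Lemma sa_scale c f : B f -> B (fun v => c * f v).
Proof. by move=> Bf; apply: (sa_mul sB) => //; apply: (sa_const sB). Qed.

Lemma sa_muln f n : B f -> B (fun v => f v *+ n).
Proof.
move=> Bf; under [X in B X]functional_extensionality do rewrite -mulr_natl.
exact: sa_scale.
Qed.

Lemma sa_opp f : B f -> B (fun v => - f v).
Proof.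
move=> Bf; under [X in B X]functional_extensionality do rewrite -mulN1r.
exact: sa_scale.
Qed.

Lemma sa_sub f g : B f -> B g -> B (fun v => f v - g v).
Proof. by move=> Bf /sa_opp; apply: (sa_add sB). Qed.

Lemma sa_exp f n : B f -> B (fun v => f v ^+ n).
Proof.
move=> Bf; elim: n => [|n IH]; first exact: (sa_const sB).
by under [X in B X]functional_extensionality do rewrite exprS; apply: (sa_mul sB).
Qed.

Lemma sa_sum (T : Type) (l : seq T) (P : pred T) (F : T -> fn) :
  (forall x, P x -> B (F x)) -> B (fun v => \sum_(x <- l | P x) F x v).
Proof.
move=> BF; elim: l => [|x l IH].
  by under [X in B X]functional_extensionality do rewrite big_nil; apply: (sa_const sB).
under [X in B X]functional_extensionality do rewrite big_cons.
by case Px: (P x) => //; apply: (sa_add sB) => //; apply: BF.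
Qed.

Lemma coefs_in_poly N (E : nat -> fn) : (forall i, B (E i)) -> coefs_in B (fun v => \poly_(i < N) E i v).
Proof.
move=> BE; split; first by exists N => v; apply: size_poly.
move=> i; under [X in B X]functional_extensionality do rewrite coef_poly.
by case: ltnP => // _; apply: (sa_const sB).
Qed.

Lemma coefs_in_C f : B f -> coefs_in B (fun v => (f v)%:P).
Proof.
move=> Bf; split; first by exists 1%N => v; apply: size_polyC_leq1.
move=> i; under [X in B X]functional_extensionality do rewrite coefC.
by case: eqP => // _; apply: (sa_const sB).
Qed.

Lemma coefs_in_const p : coefs_in B (fun=> p).
Proof. by split; [exists (size p)|move=> i; apply: (sa_const sB)]. Qed.

Lemma coefs_in_D a a' : coefs_in B a -> coefs_in B a' -> coefs_in B (fun v => a v + a' v).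
Proof.
move=> [[N sN] Ba] [[M sM] Ba']; split.
  exists (maxn N M) => v; apply: leq_trans (size_polyD _ _) _.
  by rewrite geq_max !leq_max sN sM orbT.
by move=> i; under [X in B X]functional_extensionality do rewrite coefD; apply: (sa_add sB).
Qed.

Lemma coefs_in_M a a' : coefs_in B a -> coefs_in B a' -> coefs_in B (fun v => a v * a' v).
Proof.
move=> [[N sN] Ba] [[M sM] Ba']; split.
  exists (N + M)%N => v; apply: leq_trans (size_polyMleq _ _) _.
  by apply: leq_trans (leq_pred _) _; apply: leq_add.
move=> i; under [X in B X]functional_extensionality do rewrite coefM.
by apply: sa_sum => j _; apply: (sa_mul sB).
Qed.

Lemma coefs_in_B a a' : coefs_in B a -> coefs_in B a' -> coefs_in B (fun v => a v - a' v).
Proof.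
move=> Pa Pa'; under [X in coefs_in _ X]functional_extensionality do rewrite -mulN1r.
by apply: coefs_in_D => //; apply: coefs_in_M => //; apply: coefs_in_const.
Qed.

Lemma coefs_in_exp a n : coefs_in B a -> coefs_in B (fun v => a v ^+ n).
Proof.
move=> Pa; elim: n => [|n IH]; first exact: coefs_in_const.
by under [X in coefs_in _ X]functional_extensionality do rewrite exprS; apply: coefs_in_M.
Qed.

Lemma coefs_in_sum (T : Type) (l : seq T) (F : T -> V -> {poly k}) :
  (forall x, coefs_in B (F x)) -> coefs_in B (fun v => \sum_(x <- l) F x v).
Proof.
move=> PF; elim: l => [|x l IH].
  by under [X in coefs_in _ X]functional_extensionality do rewrite big_nil; apply: coefs_in_const.
by under [X in coefs_in _ X]functional_extensionality do rewrite big_cons; apply: coefs_in_D.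
Qed.

Lemma coefs_in_deriv a : coefs_in B a -> coefs_in B (fun v => (a v)^`()).
Proof.
move=> [[N sN] Ba]; split.
  exists N => v; apply: leq_trans (sN v).
  have [->|nz] := eqVneq (a v) 0; first by rewrite deriv0.
  exact/ltnW/lt_size_deriv.
by move=> i; under [X in B X]functional_extensionality do rewrite coef_deriv; apply: sa_muln.
Qed.

Lemma sa_horner a f : coefs_in B a -> B f -> B (fun v => (a v).[f v]).
Proof.
move=> [[N sN] Ba] Bf.
under [X in B X]functional_extensionality => v do rewrite (horner_coef_wide _ (sN v)).
by apply: sa_sum => i _; apply: (sa_mul sB) => //; apply: sa_exp.
Qed.

Lemma coefs_in_comp a a' : coefs_in B a -> coefs_in B a' -> coefs_in B (fun v => a v \Po a' v).
Proof.
move=> [[N sN] Ba] Pa'.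
have E v : a v \Po a' v = \sum_(i < N) ((a v)`_i)%:P * a' v ^+ i.
  rewrite comp_polyE (big_ord_widen N (fun i => (a v)`_i *: a' v ^+ i)) // big_mkcond.
  apply: eq_bigr => i _; rewrite mul_polyC.
  by case: ltnP => // sz; rewrite nth_default ?scale0r.
under [X in coefs_in _ X]functional_extensionality do rewrite E.
by apply: coefs_in_sum => i; apply: coefs_in_M; [apply: coefs_in_C|apply: coefs_in_exp].
Qed.

End Closure.

(** What the algebraicity argument asks of [B]. Translations and grading allow a relation for a form
    [y] of degree [e] to be shifted and made homogeneous; [g_low] puts the differences
    [y (v + u) - y v] into [B]; [g_pcl] compensates for inseparability. *)
Record good (e : nat) B : Prop := Good {
  g_sub : subalg B;
  g_line : forall b u, B b ->
    coefs_in B (line_poly u b) /\ forall v t, b (vlin v t u) = (line_poly u b v).[t];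
  g_grd : forall b, B b ->
    [/\ coefs_in B (ray_poly b), forall j, Pn j (fun v => (ray_poly b v)`_j) &
        forall v t, b (vlin v0 t v) = (ray_poly b v).[t]];
  g_low : forall j f, (j < e)%N -> Pn j f -> B f;
  g_pcl : forall p m g, p \in [pchar k] -> Pn m g -> B (fun v => g v ^+ p) -> B g }.

Lemma line_poly_eq u b (q : V -> {poly k}) :
  (forall v t, b (vlin v t u) = (q v).[t]) -> line_poly u b = q.
Proof. by move=> E; apply: functional_extensionality => v; apply: interpE. Qed.

Lemma ray_poly_eq b (q : V -> {poly k}) :
  (forall v t, b (vlin v0 t v) = (q v).[t]) -> ray_poly b = q.
Proof. by move=> E; apply: functional_extensionality => v; apply: interpE. Qed.

Lemma ray_poly0 v : ray_poly (fun=> 0) v = 0.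
Proof. by rewrite (@ray_poly_eq _ (fun=> 0)) // => w t; rewrite horner0. Qed.

Lemma g_trans e B b u : good e B -> B b -> B (fun v => b (vlin v 1 u)).
Proof.
move=> gB Bb; have [Pb bE] := g_line gB u Bb.
under [X in B X]functional_extensionality do rewrite bE.
by apply: (sa_horner (g_sub gB)) => //; apply: (sa_const (g_sub gB)).
Qed.

Lemma coefs_in_trans e B a u : good e B -> coefs_in B a -> coefs_in B (fun v => a (vlin v 1 u)).
Proof.
move=> gB [[N sN] Ba]; split; first by exists N.
by move=> i; have := g_trans u gB (Ba i).
Qed.

Lemma g_ray_poly1 e B b v : good e B -> B b -> (ray_poly b v).[1] = b v.
Proof. by move=> gB /(g_grd gB)[_ _ <-]; rewrite vlin_zero1. Qed.

(** The component of total degree [N] of a polynomial over [B], the indeterminate having weight [e],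
    the degree of [y]. It serves to make relations homogeneous. *)
Lemma hom_comp e' B e y a N : good e' B -> Pn e y -> coefs_in B a ->
  exists a', [/\ coefs_in B a',
    forall i v, (a' v)`_i =
      if (e * i <= N)%N then (ray_poly (fun w => (a w)`_i) v)`_(N - e * i) else 0 &
    forall v, (a' v).[y v] = (ray_poly (fun w => (a w).[y w]) v)`_N].
Proof.
move=> gB Py [[M sM] Ba].
pose E i v := if (e * i <= N)%N then (ray_poly (fun w => (a w)`_i) v)`_(N - e * i) else 0.
have a0 i : (M <= i)%N -> (fun w => (a w)`_i) = (fun=> 0).
  move=> Mi; apply: functional_extensionality => w; apply: nth_default.
  exact: leq_trans (sM w) Mi.
exists (fun v => \poly_(i < M) E i v); split.
- apply: (coefs_in_poly (g_sub gB)) => i; rewrite /E; case: leqP => _; last exact: (sa_const (g_sub gB)).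
  by have [[_ Bc] _ _] := g_grd gB (Ba i).
- move=> i v; rewrite coef_poly; case: ltnP => // /a0 az.
  by rewrite az ray_poly0 coef0 if_same.
move=> v; rewrite horner_poly.
rewrite (@ray_poly_eq _ (fun v => \sum_(i < M) ray_poly (fun w => (a w)`_i) v * (y v ^+ i *: 'X^(e * i)))).
  rewrite coef_sum; apply: eq_bigr => i _.
  rewrite -scalerAr coefZ coefMXn mulrC /E.
  by case: leqP.
move=> w t; rewrite (horner_coef_wide _ (sM _)) horner_sum; apply: eq_bigr => i _.
have [_ _ E'] := g_grd gB (Ba i).
rewrite hornerM -(E' w t) hornerZ hornerXn (Pn_scale _ _ Py) exprMn -exprM.
by congr (_ * _); rewrite mulrC.
Qed.

(** Apart from the constant one, which is [f w], all coefficients of [f (w + t u)] are forms of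
    degree below [m]. *)
Lemma ray_poly_delta m f u v j : Pn m f -> (m <= j)%N ->
  (ray_poly (fun w => f (vlin w 1 u) - f w) v)`_j = 0.
Proof.
move=> Pf mj; have [LPf _] := line_homog_line_poly u Pf.
have E w : f (vlin w 1 u) - f w = \sum_(i < m) (line_poly u f w)`_i.+1.
  rewrite (line_polyE _ _ _ Pf) (horner_coef_wide _ (size_line_poly u w Pf)) big_ord_recl /=.
  rewrite (line_poly_coef0 _ _ Pf) mulr1 addrAC subrr add0r.
  by apply: eq_bigr => i _; rewrite expr1n mulr1.
rewrite (@ray_poly_eq _ (fun v => \sum_(i < m) (line_poly u f v)`_i.+1 *: 'X^(m - i.+1))).
  rewrite coef_sum big1 // => i _; rewrite coefZ coefXn gtn_eqF ?mulr0 //.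
  by apply: leq_trans mj; rewrite ltn_subrL (leq_ltn_trans _ (ltn_ord i)).
move=> w t; rewrite E horner_sum; apply: eq_bigr => i _.
by rewrite (Pn_scale _ _ (LPf i.+1 (ltn_ord i))) hornerZ hornerXn mulrC.
Qed.

Definition annih B y a : Prop := coefs_in B a /\ forall v, (a v).[y v] = 0.

Lemma pcl_pow e B d y q : good e B -> Pn d y -> (0 < q)%N -> [pchar k].-nat q ->
  B (fun v => y v ^+ q) -> B y.
Proof.
move=> gB Py; elim/ltn_ind: q => q IH q0 qn Bq.
have [q1|] := leqP q 1; first by move: Bq; rewrite (_ : q = 1%N) //; apply/eqP; rewrite eqn_leq q1.
move=> q1; have pp := pdiv_prime q1; have pq := pdiv_dvd q.
have pk : pdiv q \in [pchar k].
  by case/andP: qn => _ /allP; apply; rewrite mem_primes pp q0.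
have qE : (q = q %/ pdiv q * pdiv q)%N by rewrite divnK.
have q'0 : (0 < q %/ pdiv q)%N by rewrite divn_gt0 ?pdiv_gt0 // dvdn_leq.
apply: (IH (q %/ pdiv q)%N) => //.
- by rewrite ltn_Pdiv // prime_gt1.
- by apply: pnat_dvd qn; rewrite [X in (_ %| X)%N]qE dvdn_mulr.
apply: (g_pcl gB pk (PnX (q %/ pdiv q) Py)).
by under [X in B X]functional_extensionality do rewrite -exprM -qE.
Qed.

(** Write [n = q m] with [q] a power of the characteristic (1 in characteristic 0) and [m]
    invertible in [k]. The power is then [('X^q + (- y)^q)^m], whose coefficient of index
    [q (m - 1)] is [m (- y)^q]; thus [y^q] lies in [B], and roots can be taken. *)
Lemma XsubC_pow_in e B d y n : good e B -> Pn d y -> (0 < n)%N ->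
  (forall i, B (fun v => (('X - (y v)%:P) ^+ n)`_i)) -> B y.
Proof.
move=> gB Py n0 Bn; have sB := g_sub gB.
pose q := (n`_[pchar k])%N; pose m := (n`_([pchar k]^'))%N.
have qm : (q * m = n)%N by rewrite partnC.
have q0 : (0 < q)%N by rewrite part_gt0.
have m0 : m%:R != 0 :> k by rewrite natf_neq0_pchar part_pnat.
have qn : [pchar k].-nat q by apply: part_pnat.
have mE : (m = m.-1.+1)%N by rewrite prednK ?part_gt0.
have E v : (('X - (y v)%:P) ^+ n)`_(q * m.-1) = (- y v) ^+ q *+ m.
  rewrite -qm exprM -polyCN exprDn_pchar; last by rewrite (eq_pnat _ (pchar_poly _)).
  have -> : 'X^q + (- y v)%:P ^+ q = ('X + ((- y v) ^+ q)%:P) \Po 'X^q.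
    by rewrite comp_polyD comp_polyX comp_polyC [in RHS]rmorphXn.
  rewrite -rmorphXn /= coef_comp_poly_Xn // dvdn_mulr // mulKn // coef_XaddC_exp.
  have -> : (m - m.-1 = 1)%N by rewrite {1}mE subSnn.
  by have -> : 'C(m, m.-1) = m by rewrite {1}mE binSn -mE.
apply: (pcl_pow gB Py q0 qn).
have -> : (fun v => y v ^+ q) = (fun v => ((-1) ^+ q * m%:R^-1) * (('X - (y v)%:P) ^+ n)`_(q * m.-1)).
  apply: functional_extensionality => v.
  by rewrite E -mulrA -[_ ^+ q *+ m]mulr_natl mulKf // -exprMn mulN1r opprK.
exact: sa_scale.
Qed.

(** The degree of a family is its least uniform bound; it is attained somewhere, though the leading
    coefficient may vanish at other points. *)
Lemma bounded_lead a N : (forall v, (size (a v) <= N)%N) ->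
  (exists v, a v != 0) ->
  exists n, [/\ (n < N)%N, forall v, (size (a v) <= n.+1)%N & exists v, (a v)`_n != 0].
Proof.
move=> sN [w aw].
have [M [sM minM]] := @nat_min (fun N => forall v, (size (a v) <= N)%N) (ex_intro _ N sN).
have MN : (M <= N)%N by rewrite leqNgt; apply/negP => /minM; apply.
case: M => [|n] in sM minM MN *.
  by have := sM w; rewrite leqn0 size_poly_eq0 (negPf aw).
exists n; split=> //; apply: NNPP => none; apply: (minM n (ltnSn n)) => v.
apply/leq_sizeP => j; rewrite leq_eqVlt => /orP[/eqP <-|nj].
  by apply/eqP/negPn/negP => nz; apply: none; exists v.
by apply: nth_default; apply: leq_trans (sM v) nj.
Qed.

(* Take a relation of minimal degree n whose leading coefficient has minimal degree.
   Its difference with a translate has smaller leading coefficient, so the leading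
   coefficient is constant, and then the relation is invariant under translations;
   comparing with the origin shows that it is (X - y)^n. *)
Lemma alg_in e B y : good e B -> (0 < e)%N -> Pn e y ->
  (exists a, annih B y a /\ exists v, a v != 0) -> B y.
Proof.
move=> gB e0 Py [a0 [An0 nz0]]; have sB := g_sub gB.
pose rel n := exists a, [/\ annih B y a, forall v, (size (a v) <= n.+1)%N & exists v, (a v)`_n != 0].
have [n [reln minn]] : exists n, rel n /\ forall m, (m < n)%N -> ~ rel m.
  apply: nat_min; have [[N sN] _] := An0.1.
  by have [n [_ sn nzn]] := bounded_lead sN nz0; exists n, a0.
have small a : annih B y a -> (forall v, (size (a v) <= n)%N) -> forall v, a v = 0.
  move=> An sn v; apply/eqP/negPn/negP => nz.
  have [m [mn sm nzm]] := bounded_lead sn (ex_intro _ v nz).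
  by apply: (minn m mn); exists a.
(* A relation of total weight [m + e n], where [y] has weight [e]; its leading coefficient has
   degree [m]. *)
pose hrel m := exists a, [/\ annih B y a, forall v, (size (a v) <= n.+1)%N,
  exists v, (a v)`_n != 0 &
  forall i, (i <= n)%N -> Pn (m + e * (n - i)) (fun v => (a v)`_i)].
have hrelE a j v : annih B y a -> (forall v, (size (a v) <= n.+1)%N) ->
    (ray_poly (fun w => (a w)`_n) v)`_j != 0 -> hrel j.
  move=> [Pa ay] sn nzj; have [a' [Pa' a'E a'y]] := hom_comp (j + e * n) gB Py Pa.
  exists a'; split.
  - split=> // w; rewrite a'y.
    have -> : (fun w => (a w).[y w]) = (fun=> 0) by apply: functional_extensionality.
    by rewrite ray_poly0 coef0.
  - move=> w; apply/leq_sizeP => i ni; rewrite a'E.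
    have -> : (fun w => (a w)`_i) = (fun=> 0).
      by apply: functional_extensionality => x; rewrite nth_default // (leq_trans (sn x)).
    by rewrite ray_poly0 coef0 if_same.
  - by exists v; rewrite a'E leq_addl addnK.
  move=> i ni; have lei : (e * i <= j + e * n)%N.
    by apply: leq_trans (leq_addl _ _); rewrite leq_mul2l ni orbT.
  have [_ gP _] := g_grd gB (Pa.2 i).
  under [X in Pn _ X]functional_extensionality do rewrite a'E lei.
  by rewrite mulnBr addnBA ?leq_mul2l ?ni ?orbT //; apply: gP.
have ray_poly_nz b v : B b -> b v != 0 -> exists j, (ray_poly b v)`_j != 0.
  move=> Bb nzb; exists (size (ray_poly b v)).-1; rewrite -lead_coefE lead_coef_eq0.
  by apply: contra nzb => /eqP c0; rewrite -(g_ray_poly1 v gB Bb) c0 horner0.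
have [m [[a [[Pa ay] sn [w nzw] aP]] minm]] : exists m, hrel m /\ forall j, (j < m)%N -> ~ hrel j.
  apply: nat_min; have [a [An sn [v nzv]]] := reln.
  have [j nzj] := ray_poly_nz _ v (An.1.2 n) nzv.
  by exists j; apply: (hrelE a j v).
pose dl u v := y (vlin v 1 u) - y v.
(* The relation at [v + u], rewritten as one for [y v] through [y (v + u) = y v + dl u v], minus the
   relation at [v]. *)
pose a1 u v := a (vlin v 1 u) \Po ('X + (dl u v)%:P) - a v.
have By u : B (dl u).
  have [LPy _] := line_homog_line_poly u Py.
  have -> : dl u = fun v => \sum_(i < e) (line_poly u y v)`_i.+1.
    apply: functional_extensionality => v; rewrite /dl (line_polyE _ _ _ Py).
    rewrite (horner_coef_wide _ (size_line_poly u v Py)) big_ord_recl /= (line_poly_coef0 _ _ Py).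
    by rewrite mulr1 addrAC subrr add0r; apply: eq_bigr => i _; rewrite expr1n mulr1.
  apply: (sa_sum sB) => i _; apply: (g_low gB) (LPy i.+1 (ltn_ord i)).
  by rewrite ltn_subrL e0.
have An1 u : annih B y (a1 u).
  split.
    apply: (coefs_in_B sB) => //; apply: (coefs_in_comp sB); first exact: coefs_in_trans gB Pa.
    by apply: (coefs_in_D sB); [apply: (coefs_in_const sB)|apply: (coefs_in_C sB)].
  move=> v; have E : ('X + (dl u v)%:P).[y v] = y (vlin v 1 u).
    by rewrite hornerD hornerX hornerC /dl addrC subrK.
  by rewrite /a1 hornerD hornerN horner_comp E !ay subrr.
have sn1 u v : (size (a1 u v) <= n.+1)%N.
  apply: leq_trans (size_polyD _ _) _; rewrite geq_max size_polyN sn andbT.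
  by rewrite size_comp_poly2 ?size_XaddC.
have an1 u v : (a1 u v)`_n = (a (vlin v 1 u))`_n - (a v)`_n.
  by rewrite coefB coef_comp_XaddC_top.
have Pan : Pn m (fun v => (a v)`_n) by have := aP n (leqnn n); rewrite subnn muln0 addn0.
have const u v : (a (vlin v 1 u))`_n - (a v)`_n = 0.
  apply/eqP/negPn/negP; rewrite -an1 => nz.
  have [j nzj] := ray_poly_nz _ v ((An1 u).1.2 n) nz.
  have [mj|jm] := leqP m j; last exact: (minm j jm) (hrelE _ _ _ (An1 u) (sn1 u) nzj).
  move: nzj; under [X in ray_poly X]functional_extensionality do rewrite an1.
  by rewrite (ray_poly_delta _ _ Pan mj) eqxx.
pose c := (a v0)`_n.
have anc v : (a v)`_n = c.
  by apply/eqP; rewrite -subr_eq0; have := const v v0; rewrite vlin_zero1 => ->.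
have c0 : c != 0 by rewrite -(anc w).
have m0 : m = 0%N.
  by apply/eqP; rewrite -leqn0 leqNgt; apply: contra c0 => /(Pn_at0 Pan) cE; rewrite /c cE.
have a1_0 u v : a1 u v = 0.
  apply: small => // {}v; apply/leq_sizeP => j; rewrite leq_eqVlt => /orP[/eqP <-|nj].
    by rewrite an1 const.
  by apply: nth_default; apply: leq_trans (sn1 u v) nj.
have av0 : a v0 = c *: 'X^n.
  apply/polyP => i; rewrite coefZ coefXn; have [ni|ni|->] := ltngtP i n.
  - by rewrite mulr0 (Pn_at0 (aP i (ltnW ni))) // m0 add0n muln_gt0 e0 subn_gt0.
  - by rewrite mulr0 nth_default // (leq_trans (sn v0)).
  - by rewrite mulr1.
have aE u : a u = c *: ('X - (y u)%:P) ^+ n.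
  have := a1_0 u v0; rewrite /a1 /dl vlin_zero1 (Pn_at0 Py e0) subr0 av0 => /eqP.
  rewrite subr_eq0 => /eqP /(congr1 (fun p => p \Po ('X - (y u)%:P))).
  rewrite -comp_polyA comp_polyD comp_polyX comp_polyC subrK comp_polyXr => ->.
  by rewrite comp_polyZ comp_Xn_poly.
have n0 : (0 < n)%N.
  rewrite lt0n; apply: contra c0 => /eqP n0; have := ay v0.
  by rewrite aE n0 expr0 alg_polyC hornerC => ->.
apply: (XsubC_pow_in gB Py n0) => i.
have -> : (fun v => (('X - (y v)%:P) ^+ n)`_i) = (fun v => c^-1 * (a v)`_i).
  by apply: functional_extensionality => v; rewrite aE coefZ mulKf.
by apply: (sa_scale sB); apply: Pa.2.
Qed.

End Subalgebras.

(** * Adjoining a form *)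

Section Adjunction.
Variables (k : closedFieldType) (I : choiceType).
Local Notation V := (vect k I).
Local Notation fn := (V -> k).
Local Notation v0 := (vzero I k).
Implicit Types (u v : V) (f g h y b : fn) (a : V -> {poly k}) (B : fn -> Prop).

Definition adjoin B y f : Prop := exists a, coefs_in B a /\ forall v, f v = (a v).[y v].

Lemma adjoin_incl B y f : subalg B -> B f -> adjoin B y f.
Proof.
by move=> sB Bf; exists (fun v => (f v)%:P); split=> [|v]; [apply: coefs_in_C|rewrite hornerC].
Qed.

Lemma adjoin_gen B y : subalg B -> adjoin B y y.
Proof. by move=> sB; exists (fun=> 'X); split=> [|v]; [apply: coefs_in_const|rewrite hornerX]. Qed.

Lemma adjoin_subalg B y : subalg B -> subalg (adjoin B y).
Proof.
move=> sB; split.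
- by move=> c; apply: adjoin_incl => //; apply: (sa_const sB).
- move=> f g [a [Pa fE]] [a' [Pa' gE]]; exists (fun v => a v + a' v).
  by split=> [|v]; [apply: coefs_in_D|rewrite hornerD fE gE].
- move=> f g [a [Pa fE]] [a' [Pa' gE]]; exists (fun v => a v * a' v).
  by split=> [|v]; [apply: coefs_in_M|rewrite hornerM fE gE].
Qed.

Lemma adjoin_le B B' y f : (forall g, B g -> B' g) -> adjoin B y f -> adjoin B' y f.
Proof. by move=> BB' [a [Pa fE]]; exists a; split=> //; apply: coefs_in_mono Pa. Qed.

Lemma adjoin_min B B' y f : subalg B' -> (forall g, B g -> B' g) -> B' y -> adjoin B y f -> B' f.
Proof.
move=> sB' BB' By [a [Pa fE]]; have -> : f = fun v => (a v).[y v] by apply: functional_extensionality.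
by apply: sa_horner => //; apply: coefs_in_mono Pa.
Qed.

Section Good.
Variables (e : nat) (B : fn -> Prop) (y : fn).
Hypotheses (gB : good e B) (e0 : (0 < e)%N) (Py : Pn e y).
Let sB := g_sub gB.
Let sA := adjoin_subalg y sB.

Lemma line_poly_low_in u j : B (fun v => (line_poly u y v)`_j.+1).
Proof.
have [LPy LP0] := line_homog_line_poly u Py; have [je|ej] := leqP j.+1 e.
  by apply: (g_low gB) (LPy _ je); rewrite ltn_subrL e0.
under [X in B X]functional_extensionality do rewrite LP0 //.
exact: (sa_const sB).
Qed.

Lemma line_poly_adjoin u a N v : coefs_in B a -> (forall v, (size (a v) <= N)%N) ->
  line_poly u (fun w => (a w).[y w]) v = \sum_(i < N) line_poly u (fun w => (a w)`_i) v * line_poly u y v ^+ i.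
Proof.
move=> Pa sN; apply: interpE => t; rewrite (horner_coef_wide _ (sN _)) horner_sum.
apply: eq_bigr => i _; rewrite hornerM horner_exp -(line_polyE _ _ _ Py).
by have [_ <-] := g_line gB u (Pa.2 i).
Qed.

Lemma adjoin_line b u : adjoin B y b ->
  coefs_in (adjoin B y) (line_poly u b) /\ forall v t, b (vlin v t u) = (line_poly u b v).[t].
Proof.
case=> a [Pa bE]; have {bE} -> : b = fun v => (a v).[y v] by apply: functional_extensionality.
have [[N sN] Ba] := Pa.
have E v := line_poly_adjoin u v Pa sN; split.
  under [X in coefs_in _ X]functional_extensionality do rewrite E.
  apply: (coefs_in_sum sA) => i; apply: (coefs_in_M sA).
    apply: coefs_in_mono (g_line gB u (Ba i)).1 => f; exact: adjoin_incl.
  apply: (coefs_in_exp sA); split; first by exists e.+1 => v; apply: size_line_poly.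
  case=> [|j]; last by apply: adjoin_incl => //; apply: line_poly_low_in.
  by under [X in adjoin _ _ X]functional_extensionality do rewrite (line_poly_coef0 _ _ Py); apply: adjoin_gen.
move=> v t; rewrite E (horner_coef_wide _ (sN _)) horner_sum.
apply: eq_bigr => i _; rewrite hornerM horner_exp -(line_polyE _ _ _ Py).
by have [_ <-] := g_line gB u (Ba i).
Qed.

Lemma adjoin_grd b : adjoin B y b ->
  [/\ coefs_in (adjoin B y) (ray_poly b), forall j, Pn j (fun v => (ray_poly b v)`_j) &
        forall v t, b (vlin v0 t v) = (ray_poly b v).[t]].
Proof.
case=> a [Pa bE]; have {bE} -> : b = fun v => (a v).[y v] by apply: functional_extensionality.
have [[N sN] Ba] := Pa.
have E0 v t : (a (vlin v0 t v)).[y (vlin v0 t v)] =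
    (\sum_(i < N) ray_poly (fun w => (a w)`_i) v * (y v ^+ i *: 'X^(e * i))).[t].
  rewrite (horner_coef_wide _ (sN _)) horner_sum; apply: eq_bigr => i _.
  have [_ _ E'] := g_grd gB (Ba i).
  rewrite hornerM -(E' v t) hornerZ hornerXn (Pn_scale _ _ Py) exprMn -exprM.
  by congr (_ * _); rewrite mulrC.
rewrite (ray_poly_eq E0); split=> //.
  apply: (coefs_in_sum sA) => i; apply: (coefs_in_M sA).
    have [Pc _ _] := g_grd gB (Ba i); apply: coefs_in_mono Pc => f; exact: adjoin_incl.
  under [X in coefs_in _ X]functional_extensionality do rewrite -mul_polyC.
  apply: (coefs_in_M sA); last exact: (coefs_in_const sA).
  by apply: (coefs_in_C sA); apply: (sa_exp sA); apply: adjoin_gen.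
move=> j; under [X in Pn _ X]functional_extensionality do rewrite coef_sum.
apply: Pn_sum => i _; have [_ Pc _] := g_grd gB (Ba i).
have [ij|ij] := ltnP j (e * i).
  under [X in Pn _ X]functional_extensionality do rewrite -scalerAr coefZ coefMXn ij mulr0.
  exact: Pn_zero.
under [X in Pn _ X]functional_extensionality do rewrite -scalerAr coefZ coefMXn ltnNge ij /=.
by have := PnM (PnX i Py) (Pc (j - e * i)%N); rewrite subnKC.
Qed.

Hypothesis yB : ~ B y.

(** Allows coefficients to be compared in identities that are polynomial in [y]. *)
Lemma transcendental a : annih B y a -> forall v, a v = 0.
Proof.
move=> An v; apply/eqP/negPn/negP => nz; apply: yB.
by apply: (alg_in gB e0 Py); exists a; split=> //; exists v.
Qed.

(** * Closure under p-th roots after adjoining a transcendental form *)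

Section Frobenius.
Variables (p : nat) (pk : p \in [pchar k]).
Let pp : prime p := pcharf_prime pk.

(** The difference is the sum of the line coefficients of [g] of positive index, which have degree
    below [m]. The [p]-th power of the one of index [j] is the line coefficient of [g^p] of index
    [j p], so the induction hypothesis applies. *)
Lemma adjoin_pth_diff m g u :
  (forall j, (j < m)%N -> forall f, Pn j f -> adjoin B y (fun v => f v ^+ p) -> adjoin B y f) ->
  Pn m g -> adjoin B y (fun v => g v ^+ p) ->
  adjoin B y (fun v => g (vlin v 1 u) - g v).
Proof.
move=> IH Pg Ag; have [LPg LP0] := line_homog_line_poly u Pg.
have shE v : line_poly u (fun w => g w ^+ p) v = line_poly u g v ^+ p.
  by apply: interpE => t; rewrite horner_exp -(line_polyE _ _ _ Pg).
have Aj j : adjoin B y (fun v => (line_poly u g v)`_j ^+ p).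
  have [[_ Aj] _] := adjoin_line u Ag.
  suff <- : (fun v => (line_poly u (fun w => g w ^+ p) v)`_(j * p)) = (fun v => (line_poly u g v)`_j ^+ p) by [].
  apply: functional_extensionality => v; rewrite shE (coef_exp_pchar _ _ pk) dvdn_mull //.
  by rewrite mulnK // prime_gt0.
have -> : (fun v => g (vlin v 1 u) - g v) = fun v => \sum_(i < m) (line_poly u g v)`_i.+1.
  apply: functional_extensionality => v; rewrite (line_polyE _ _ _ Pg).
  rewrite (horner_coef_wide _ (size_line_poly u v Pg)) big_ord_recl /= (line_poly_coef0 _ _ Pg).
  by rewrite mulr1 addrAC subrr add0r; apply: eq_bigr => i _; rewrite expr1n mulr1.
apply: (sa_sum sA) => i _; apply: IH _ _ (LPg _ (ltn_ord i)) (Aj i.+1).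
by rewrite ltn_subrL (leq_ltn_trans _ (ltn_ord i)).
Qed.

(** Differentiating [g^p = sum a_i y^i] along [u] gives 0 on the left. On the right it gives a
    polynomial in [y] with coefficients in [B], as the derivative of [y] has degree below [e]; by
    transcendence each coefficient vanishes. *)
Lemma adjoin_deriv_rel g m a : Pn m g -> coefs_in B a -> (forall v, g v ^+ p = (a v).[y v]) ->
  forall u i v, (line_poly u (fun w => (a w)`_i) v)`_1 + (a v)`_i.+1 * (line_poly u y v)`_1 *+ i.+1 = 0.
Proof.
move=> Pg Pa gE u i v; have [[N sN] Ba] := Pa.
pose D v := \poly_(i < N) (line_poly u (fun w => (a w)`_i) v)`_1.
have Di w : (D w)`_i = (line_poly u (fun w => (a w)`_i) w)`_1.
  rewrite coef_poly; case: ltnP => // Ni.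
  have -> : (fun w => (a w)`_i) = (fun=> 0).
    by apply: functional_extensionality => x; rewrite nth_default // (leq_trans (sN x)).
  by rewrite (@line_poly_eq _ _ _ _ (fun=> 0)) ?coef0 // => x t; rewrite horner0.
pose a' v := D v + (a v)^`() * ((line_poly u y v)`_1)%:P.
have : a' v = 0.
  apply: transcendental; split.
    apply: (coefs_in_D sB).
      by apply: (coefs_in_poly sB) => j; apply: (g_line gB u (Ba j)).1.2.
    by apply: (coefs_in_M sB); [apply: coefs_in_deriv|apply: (coefs_in_C sB); apply: line_poly_low_in].
  move=> w.
  have E : line_poly u (fun w => g w ^+ p) w = line_poly u g w ^+ p.
    by apply: interpE => t; rewrite horner_exp -(line_polyE _ _ _ Pg).
  have : (line_poly u (fun w => g w ^+ p) w)`_1 = 0.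
    by rewrite E (coef_exp_pchar _ _ pk) gtnNdvd // prime_gt1.
  have -> : (fun w => g w ^+ p) = (fun w => (a w).[y w]) by apply: functional_extensionality.
  rewrite (line_poly_adjoin u w Pa sN) coef_sum => S0.
  have aE : a w = \sum_(j < N) (a w)`_j *: 'X^j.
    rewrite -poly_def; apply/polyP => j; rewrite coef_poly; case: ltnP => // Nj.
    by rewrite nth_default // (leq_trans (sN w)).
  rewrite hornerD hornerM hornerC horner_poly {1}aE raddf_sum horner_sum -[RHS]S0.
  rewrite big_distrl -big_split; apply: eq_bigr => j _ /=.
  rewrite coef1M coef1X (line_poly_coef0 _ _ Py).
  have -> : (line_poly u y w ^+ j)`_0 = y w ^+ j.
    by rewrite -horner_coef0 horner_exp horner_coef0 (line_poly_coef0 _ _ Py).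
  have -> : (line_poly u (fun w => (a w)`_j) w)`_0 = (a w)`_j.
    by rewrite -horner_coef0 -(g_line gB u (Ba j)).2 vlin0.
  rewrite addrC derivZ derivXn hornerZ hornerMn hornerXn; congr (_ + _).
  by rewrite -mulrA mulrnAl.
move/(congr1 (fun q : {poly k} => q`_i)); rewrite coef0 coefD coefMC coef_deriv Di.
by rewrite mulrnAl.
Qed.

(* Write g^p = sum_i a_i y^i with y transcendental over B. If p does not divide i and i is
   maximal with a_i <> 0, then a_i is a constant c, since g^p changes by a p-th power under
   translation. As g^p has no first derivatives, neither has a_(i-1) + i c y, so this
   is a p-th power of an element of B, and y is in B. *)
Lemma adjoin_pcl m g : Pn m g -> adjoin B y (fun v => g v ^+ p) -> adjoin B y g.
Proof.
elim/ltn_ind: m g => m IH g Pg Ag.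
have Pgp := PnX p Pg.
have [a1 [Pa1 gE1]] := Ag.
have [a [Pa aE aN]] := hom_comp (m * p) gB Py Pa1.
have gE v : g v ^+ p = (a v).[y v].
  rewrite aN; have <- : (fun w => g w ^+ p) = (fun w => (a1 w).[y w]).
    exact: functional_extensionality.
  by rewrite (ray_poly_Pn _ Pgp) coefZ coefXn eqxx mulr1.
have Pai i : Pn (m * p - e * i) (fun v => (a v)`_i).
  under [X in Pn _ X]functional_extensionality do rewrite aE.
  case: (leqP (e * i) (m * p)) => _; last exact: Pn_zero.
  by have [_ Pc _] := g_grd gB (Pa1.2 i); apply: Pc.
have az i v : (m * p < e * i)%N -> (a v)`_i = 0 by move=> lt; rewrite aE leqNgt lt.
have [[N sN] Ba] := Pa.
have Drel := adjoin_deriv_rel Pg Pa gE.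
have p0 : (0 < p)%N := prime_gt0 pp.
have const u v i : ~~ (p %| i)%N -> (forall j w, (i < j)%N -> ~~ (p %| j)%N -> (a w)`_j = 0) ->
    (a (vlin v 1 u))`_i = (a v)`_i.
  move=> pi big0.
  have [c [Pc cE]] := adjoin_pth_diff u IH Pg Ag.
  pose dl w := y (vlin w 1 u) - y w.
  (* The change of [g^p] under translation, expanded in [y], minus the [p]-th power of the expansion
     [c] of the change of [g]: a relation for [y], hence zero. *)
  pose A w := a (vlin w 1 u) \Po ('X + (dl w)%:P) - a w - c w ^+ p.
  have Bdl : B dl.
    have -> : dl = fun v => \sum_(i < e) (line_poly u y v)`_i.+1.
      apply: functional_extensionality => w; rewrite /dl (line_polyE _ _ _ Py).
      rewrite (horner_coef_wide _ (size_line_poly u w Py)) big_ord_recl /= (line_poly_coef0 _ _ Py).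
      by rewrite mulr1 addrAC subrr add0r; apply: eq_bigr => l _; rewrite expr1n mulr1.
    by apply: (sa_sum sB) => l _; apply: line_poly_low_in.
  have : A v = 0.
    apply: transcendental; split.
      apply: (coefs_in_B sB); last exact: (coefs_in_exp sB).
      apply: (coefs_in_B sB) => //; apply: (coefs_in_comp sB); first exact: coefs_in_trans gB Pa.
      by apply: (coefs_in_D sB); [apply: (coefs_in_const sB)|apply: (coefs_in_C sB)].
    move=> w; have E : ('X + (dl w)%:P).[y w] = y (vlin w 1 u).
      by rewrite hornerD hornerX hornerC /dl addrC subrK.
    rewrite /A !hornerD !hornerN horner_comp E -!gE horner_exp -cE.
    rewrite -!(pFrobenius_autE pk) -!rmorphB /= subrr.
    exact: rmorph0.
  move/(congr1 (fun q : {poly k} => q`_i)); rewrite coef0 !coefB (coef_exp_pchar _ _ pk).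
  rewrite (negPf pi) subr0 => /eqP; rewrite subr_eq0 => /eqP <-.
  have sN' w : (size (a w) <= maxn N i.+1)%N by rewrite leq_max sN.
  have iN : (i < maxn N i.+1)%N by rewrite leq_max ltnSn orbT.
  rewrite (coef_comp_XaddC _ _ (sN' _)) (bigD1 (Ordinal iN)) //= subnn binn mulr1.
  rewrite big1 ?addr0 // => l li; have [il|li'] := ltnP i l; last first.
    rewrite bin_small ?mulr0n ?mulr0 // ltn_neqAle li' andbT.
    by apply: contra li => /eqP E; apply/eqP/val_inj.
  (* Indices [l > i] prime to [p] drop out by maximality of [i]; for the others [C(l, i)] is 0 in
     [k]. *)
  have [pl|npl] := boolP (p %| l)%N; last by rewrite big0 // mul0r.
  by rewrite -mulr_natr (bin_pchar_eq0 pk pl pi) !mulr0.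
have nondiv i v : ~~ (p %| i)%N -> (a v)`_i = 0.
  move=> pi; have [n] := ubnP (N - i); elim: n i pi v => // n IHn i pi v.
  rewrite ltnS => le.
  have big0 j w : (i < j)%N -> ~~ (p %| j)%N -> (a w)`_j = 0.
    move=> ij pj; have [Nj|jN] := leqP N j; first by rewrite nth_default // (leq_trans (sN w)).
    apply: IHn => //; apply: leq_trans le; apply: ltn_sub2l => //; exact: ltn_trans jN.
  have cst w : (a w)`_i = (a v0)`_i by rewrite -(const w v0 i pi big0) vlin_zero1.
  apply/eqP/negPn/negP => nz.
  have c0 : (a v0)`_i != 0 by rewrite -(cst v).
  (* A nonzero constant [a_i] has degree 0. Hence [a_(i-1)] has degree [e], the same as [y], and the
     two can be added in [x]. *)
  have degE : (m * p = e * i)%N.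
    apply/eqP; rewrite eqn_leq -subn_eq0; apply/andP; split.
      rewrite -leqn0 leqNgt; apply: contra c0 => lt0.
      by rewrite (Pn_at0 (Pai i)).
    by rewrite leqNgt; apply: contra c0 => /az ->.
  have i0 : (i = i.-1.+1)%N by rewrite prednK // lt0n; apply: contraNneq pi => ->; rewrite dvdn0.
  pose c := (a v0)`_i *+ i.
  have cn0 : c != 0 by rewrite /c -mulr_natr mulf_neq0 // -(dvdn_pcharf pk).
  pose x v := (a v)`_i.-1 + c * y v.
  have Px : Pn e x.
    apply: PnD; last exact: PnZ.
    have := Pai i.-1; rewrite degE -mulnBr; congr Pn.
    by rewrite {1}i0 subSnn muln1.
  have [u w|z [Pz zE]] := Pn_root pk Px.
    have -> : line_poly u x w = line_poly u (fun w => (a w)`_i.-1) w + c *: line_poly u y w.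
      apply: interpE => t; rewrite hornerD hornerZ -(line_polyE _ _ _ Py).
      by rewrite -(g_line gB u (Ba i.-1)).2.
    rewrite coefD coefZ -[RHS](Drel u i.-1 w) -i0 cst; congr (_ + _).
    by rewrite /c -mulrnAl.
  have Bz : B z by apply: (g_low gB) Pz; rewrite ltn_Pdiv // prime_gt1.
  apply: yB; have -> : y = fun v => c^-1 * (z v ^+ p - (a v)`_i.-1).
    by apply: functional_extensionality => w; rewrite zE /x addrAC subrr add0r mulKf.
  by apply: (sa_scale sB); apply: (sa_sub sB) => //; apply: (sa_exp sB).
(* Only indices divisible by [p] remain. The derived relations then say that [a_(jp)] has no first
   derivatives, so it is the [p]-th power of a form, which lies in [B]. *)
have roots j : exists z, B z /\ forall v, z v ^+ p = (a v)`_(j * p).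
  have [u v|z [Pz zE]] := Pn_root pk (Pai (j * p)%N).
    rewrite -[RHS](Drel u (j * p)%N v) nondiv ?mul0r ?mul0rn ?addr0 //.
    by rewrite -addn1 dvdn_addr ?dvdn_mull // dvdn1 neq_ltn prime_gt1 ?orbT.
  exists z; split=> //; apply: (g_pcl gB pk Pz).
  by under [X in B X]functional_extensionality do rewrite zE.
have [z zP] := fun_choice roots.
exists (fun v => \poly_(j < N) z j v); split.
  by apply: (coefs_in_poly sB) => j; apply: (zP j).1.
have Finj : injective (fun x : k => x ^+ p) by exact: (fmorph_inj (pFrobenius_aut pk)).
move=> v; apply: Finj; rewrite /= gE -horner_exp.
congr (_.[_]); apply/polyP => i; rewrite (coef_exp_pchar _ _ pk) coef_poly.
have [pi|npi] := boolP (p %| i)%N; last by rewrite nondiv.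
case: ltnP => iN; first by rewrite (zP _).2 divnK.
rewrite expr0n gtn_eqF // nth_default //; apply: leq_trans (sN v) _.
exact: leq_trans iN (leq_div _ _).
Qed.

End Frobenius.
End Good.

Lemma adjoin_good e B y : (0 < e)%N -> good e B -> Pn e y -> good e (adjoin B y).
Proof.
move=> e0 gB Py; have sB := g_sub gB; split.
- exact: adjoin_subalg.
- by move=> b u; apply: adjoin_line gB e0 Py _ _.
- by move=> b; apply: (adjoin_grd gB).
- by move=> j f je Pf; apply: adjoin_incl => //; apply: (g_low gB je).
move=> p m g pk Pg Ag; have [By|nBy] := classic (B y); last exact: (adjoin_pcl gB e0 Py nBy pk Pg).
apply: adjoin_incl => //; apply: (g_pcl gB pk Pg).
exact: (adjoin_min sB) Ag.
Qed.

End Adjunction.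

(** * The algebra generated by forms of bounded degree *)

(** Lists of functions have no decidable membership, hence a recursive conjunction. *)
Fixpoint lall (T : Type) (Q : T -> Prop) (s : seq T) : Prop :=
  if s is x :: s' then Q x /\ lall Q s' else True.

Lemma lall_cat T (Q : T -> Prop) s s' : lall Q (s ++ s') <-> lall Q s /\ lall Q s'.
Proof. by elim: s => [|x s IH] /=; [split=> [|[]]|rewrite IH; tauto]. Qed.

Lemma lall_impl T (Q Q' : T -> Prop) s : (forall x, Q x -> Q' x) -> lall Q s -> lall Q' s.
Proof. by move=> QQ'; elim: s => //= x s IH [/QQ' ? /IH]. Qed.

Lemma lall_and T (Q Q' : T -> Prop) s :
  lall Q s -> lall Q' s -> lall (fun x => Q x /\ Q' x) s.
Proof. by elim: s => //= x s IH [Qx Qs] [Q'x Q's]; split=> //; apply: IH. Qed.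

Lemma lall_map T U (g : T -> U) (Q : U -> Prop) s :
  lall Q (map g s) <-> lall (fun x => Q (g x)) s.
Proof. by elim: s => //= x s IH; rewrite IH. Qed.

Lemma lall_seqP (T : eqType) (Q : T -> Prop) s :
  lall Q s <-> forall x, x \in s -> Q x.
Proof.
elim: s => [|x s IH] //=; rewrite IH; split=> [[Qx Qs] z|H].
  by rewrite inE => /orP[/eqP ->|/Qs].
by split=> [|z zs]; apply: H; rewrite inE ?eqxx ?zs ?orbT.
Qed.

Lemma lall_map_seq (T : eqType) U (g : T -> U) (Q : U -> Prop) s :
  lall Q (map g s) <-> forall x, x \in s -> Q (g x).
Proof. by rewrite lall_map lall_seqP. Qed.

Lemma lall_flatten T U (g : T -> seq U) (Q : U -> Prop) s :
  lall Q (flatten (map g s)) <-> lall (fun x => lall Q (g x)) s.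
Proof. by elim: s => //= x s IH; rewrite lall_cat IH. Qed.

Section Generated.
Variables (k : closedFieldType) (I : choiceType).
Local Notation V := (vect k I).
Local Notation fn := (V -> k).
Local Notation v0 := (vzero I k).
Implicit Types (u v : V) (f g h y b : fn) (a : V -> {poly k}) (B : fn -> Prop).

Definition adjoins B (s : seq fn) : fn -> Prop := foldr (fun y A => adjoin A y) B s.

Lemma adjoins_subalg B s : subalg B -> subalg (adjoins B s).
Proof. by move=> sB; elim: s => //= y s IH; apply: adjoin_subalg. Qed.

Lemma adjoins_incl B s f : subalg B -> B f -> adjoins B s f.
Proof.
by move=> sB Bf; elim: s => //= y s IH; apply: adjoin_incl => //; apply: adjoins_subalg.
Qed.

Lemma adjoins_gen B s : subalg B -> lall (adjoins B s) s.
Proof.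
move=> sB; elim: s => //= y s IH; split; first exact/adjoin_gen/adjoins_subalg.
by apply: lall_impl IH => f; apply: adjoin_incl; apply: adjoins_subalg.
Qed.

Lemma adjoins_le B B' s f : (forall g, B g -> B' g) -> adjoins B s f -> adjoins B' s f.
Proof.
move=> BB'; elim: s f => [|y s IH] f /=; first exact: BB'.
exact: adjoin_le.
Qed.

Lemma adjoins_cat B s s' : adjoins B (s ++ s') = adjoins (adjoins B s') s.
Proof. by rewrite /adjoins foldr_cat. Qed.

Lemma adjoins_min B B' s f : subalg B' -> (forall g, B g -> B' g) -> lall B' s ->
  adjoins B s f -> B' f.
Proof.
move=> sB' BB'; elim: s f => [|y s IH] f /=; first by move=> _; apply: BB'.
by case=> By Bs; apply: adjoin_min => // g; apply: IH.
Qed.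

Lemma adjoins_good e B s : (0 < e)%N -> good e B -> lall (Pn e) s -> good e (adjoins B s).
Proof. by move=> e0 gB; elim: s => //= y s IH [Py /IH gs]; apply: adjoin_good. Qed.

(** Built one degree at a time: an element involves only finitely many generators of the top degree,
    so its properties follow by adjoining single forms. *)
Fixpoint alg_upto (e : nat) : fn -> Prop :=
  if e is e'.+1 then fun f => exists s, lall (Pn e) s /\ adjoins (alg_upto e') s f
  else fun f => exists c, f = fun=> c.

(** Adjoining finitely many forms of degree [e + 1] keeps the level [e + 1]. The union over all
    finite lists is directed, and it contains every form of degree [e + 1], which raises the level
    by one. *)
Lemma alg_upto_good e : good e.+1 (alg_upto e).
Proof.
elim: e => [|e gA].
  have sC : subalg (alg_upto 0).
    split=> [c|f g [c ->] [c' ->]|f g [c ->] [c' ->]]; first by exists c.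
      by exists (c + c').
    by exists (c * c').
  split=> //.
  - move=> b u [c ->]; rewrite (@line_poly_eq _ _ _ _ (fun=> c%:P)); last by move=> v t; rewrite hornerC.
    by split=> [|v t]; [apply: coefs_in_const|rewrite hornerC].
  - move=> b [c ->]; rewrite (@ray_poly_eq _ _ _ (fun=> c%:P)); last by move=> v t; rewrite hornerC.
    split=> [|j|v t]; [exact: coefs_in_const| |by rewrite hornerC].
    case: j => [|j]; rewrite coefC; [exact: PnC|exact: Pn_zero].
  - case=> // f _ Pf; exists (f v0); apply: functional_extensionality => v; exact: Pn0_const.
  (* A form of positive degree vanishes at the origin; if its [p]-th power is constant, that
     constant is 0. *)
  move=> p [|m] g pk Pg [c gE].
    by exists (g v0); apply: functional_extensionality => v; exact: Pn0_const.
  have p0 := prime_gt0 (pcharf_prime pk).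
  have gE' v : g v ^+ p = c by rewrite -[LHS]/((fun w => g w ^+ p) v) gE.
  exists 0; apply: functional_extensionality => v; apply/eqP.
  have := gE' v0; rewrite (Pn_at0 Pg) // expr0n gtn_eqF // => c0.
  by have /eqP := gE' v; rewrite -c0 expf_eq0 p0.
have sA := g_sub gA.
have gs s : lall (Pn e.+1) s -> good e.+1 (adjoins (alg_upto e) s) by apply: adjoins_good.
have inc s f : lall (Pn e.+1) s -> adjoins (alg_upto e) s f -> alg_upto e.+1 f by exists s.
split.
- split=> [c|f g [s [Ps Af]] [s' [Ps' Ag]]|f g [s [Ps Af]] [s' [Ps' Ag]]].
  + by exists [::]; split=> //; apply: (sa_const sA).
  + exists (s ++ s'); rewrite lall_cat adjoins_cat; split=> //.
    apply: (sa_add (adjoins_subalg _ (adjoins_subalg _ sA))).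
      by apply: adjoins_le Af => h; apply: adjoins_incl.
    by apply: adjoins_incl => //; apply: adjoins_subalg.
  + exists (s ++ s'); rewrite lall_cat adjoins_cat; split=> //.
    apply: (sa_mul (adjoins_subalg _ (adjoins_subalg _ sA))).
      by apply: adjoins_le Af => h; apply: adjoins_incl.
    by apply: adjoins_incl => //; apply: adjoins_subalg.
- move=> b u [s [Ps Ab]]; have [Pb bE] := g_line (gs s Ps) u Ab; split=> //.
  by apply: coefs_in_mono Pb => f; apply: inc.
- move=> b [s [Ps Ab]]; have [Pb bP bE] := g_grd (gs s Ps) Ab; split=> //.
  by apply: coefs_in_mono Pb => f; apply: inc.
- move=> j f; rewrite ltnS leq_eqVlt => /orP[/eqP -> Pf|je Pf].
    by exists [:: f]; split=> //=; apply: adjoin_gen.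
  by exists [::]; split=> //; apply: (g_low gA) Pf.
- move=> p m g pk Pg [s [Ps Ag]]; apply: (inc s) => //.
  exact: (g_pcl (gs s Ps)) Pg Ag.
Qed.

(** * Degree d components of the generated algebra *)

Section DegreePart.
Variables (d : nat) (S : fn -> Prop).
Hypotheses (d0 : (0 < d)%N) (S0 : S (fun=> 0)).
Hypothesis Sadd : forall f g, S f -> S g -> S (fun v => f v + g v).
Hypothesis SZ : forall c f, S f -> S (fun v => c * f v).
Hypothesis SM : forall i j f g, (0 < i)%N -> (0 < j)%N -> (i + j = d)%N ->
  Pn i f -> Pn j g -> S (fun v => f v * g v).

(** [q v] is the generating polynomial of the homogeneous components of [f] at [v], so products of
    functions become products of polynomials. *)
Definition degpart f : Prop := exists q : V -> {poly k},
  [/\ forall j, Pn j (fun v => (q v)`_j), forall v, f v = (q v).[1] &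
      S (fun v => (q v)`_d)].

(** In degree [d] a product consists of constants times degree [d] components of the factors,
    covered by [SZ], and of products of forms of positive degree, covered by [SM]. *)
Lemma degpart_subalg : subalg degpart.
Proof.
split.
- move=> c; exists (fun=> c%:P); split=> [j|v|]; last by rewrite coefC gtn_eqF.
    by rewrite coefC; case: eqP => [->|_]; [apply: PnC|apply: Pn_zero].
  by rewrite hornerC.
- move=> f g [q [Pq fE Sq]] [r [Pr gE Sr]]; exists (fun v => q v + r v); split=> [j|v|].
  + by under [X in Pn _ X]functional_extensionality do rewrite coefD; apply: PnD.
  + by rewrite hornerD fE gE.
  + by under [X in S X]functional_extensionality do rewrite coefD; apply: Sadd.
- move=> f g [q [Pq fE Sq]] [r [Pr gE Sr]]; exists (fun v => q v * r v); split=> [j|v|].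
  + under [X in Pn _ X]functional_extensionality do rewrite coefM.
    apply: Pn_sum => i _; have ij : (i <= j)%N by rewrite -ltnS.
    by have := PnM (Pq i) (Pr (j - i)%N); rewrite subnKC.
  + by rewrite hornerM fE gE.
  + under [X in S X]functional_extensionality do rewrite coefM.
    have SS (l : seq 'I_d.+1) : S (fun v => \sum_(i <- l) (q v)`_i * (r v)`_(d - i)).
      elim: l => [|i l IH]; first by under [X in S X]functional_extensionality do rewrite big_nil.
      under [X in S X]functional_extensionality do rewrite big_cons.
      apply: Sadd => //; have id : (i <= d)%N by rewrite -ltnS.
      have [i0|i0] := posnP i.
        under [X in S X]functional_extensionality do rewrite i0 subn0 (Pn0_const _ (Pq 0%N)).
        exact: SZ.
      have [di|di] := posnP (d - i).
        have -> : (i : nat) = d by apply/eqP; rewrite eqn_leq id -subn_eq0 di.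
        under [X in S X]functional_extensionality do rewrite subnn (Pn0_const _ (Pr 0%N)) mulrC.
        exact: SZ.
      by apply: (SM i0 di) => //; rewrite subnKC.
    exact: SS.
Qed.

Lemma Pn_coefZXn j f i : Pn j f -> Pn i (fun v => (f v *: 'X^j)`_i).
Proof.
move=> Pf; have [->|ij] := eqVneq i j.
  by under [X in Pn _ X]functional_extensionality do rewrite coefZ coefXn eqxx mulr1.
under [X in Pn _ X]functional_extensionality do rewrite coefZ coefXn (negPf ij) mulr0.
exact: Pn_zero.
Qed.

Lemma degpart_low j f : j != d -> Pn j f -> degpart f.
Proof.
move=> jd Pf; exists (fun v => f v *: 'X^j); split=> [i|v|].
- exact: Pn_coefZXn.
- by rewrite hornerZ hornerXn expr1n mulr1.
- under [X in S X]functional_extensionality do rewrite coefZ coefXn eq_sym (negPf jd) mulr0.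
  exact: S0.
Qed.

Lemma degpart_top f : Pn d f -> S f -> degpart f.
Proof.
move=> Pf Sf; exists (fun v => f v *: 'X^d); split=> [i|v|].
- exact: Pn_coefZXn.
- by rewrite hornerZ hornerXn expr1n mulr1.
- by under [X in S X]functional_extensionality do rewrite coefZ coefXn eqxx mulr1.
Qed.

Lemma degpart_homog f : Pn d f -> degpart f -> S f.
Proof.
move=> Pf [q [Pq fE Sq]].
have E : ray_poly f = q.
  apply: ray_poly_eq => v t; rewrite fE.
  pose N := maxn (size (q (vlin v0 t v))) (size (q v)).
  rewrite (@horner_coef_wide _ N) ?leq_maxl // (@horner_coef_wide _ N (q v)) ?leq_maxr //.
  by apply: eq_bigr => j _; rewrite (Pn_scale _ _ (Pq j)) expr1n mulr1 mulrC.
suff -> : f = fun v => (q v)`_d by [].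
apply: functional_extensionality => v; rewrite -E (ray_poly_Pn _ Pf) coefZ coefXn eqxx.
by rewrite mulr1.
Qed.

Lemma alg_upto_degpart e f : (e < d)%N -> alg_upto e f -> degpart f.
Proof.
elim: e f => [|e IH] f ed /=.
  by case=> c ->; apply: (sa_const degpart_subalg).
case=> s [Ps]; apply: adjoins_min; first exact: degpart_subalg.
  by move=> g; apply: IH; apply: ltnW.
by apply: lall_impl Ps => y; apply: degpart_low; rewrite neq_ltn ed.
Qed.

Lemma adjoins_alg_upto_homog s f : lall (fun y => Pn d y /\ S y) s -> Pn d f ->
  adjoins (alg_upto d.-1) s f -> S f.
Proof.
move=> Ps Pf Af; apply: degpart_homog => //; apply: adjoins_min Af.
- exact: degpart_subalg.
- by move=> g; apply: alg_upto_degpart; rewrite prednK.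
- by apply: lall_impl Ps => y [Py Sy]; apply: degpart_top.
Qed.

End DegreePart.

End Generated.

(** * Elimination *)

Section Elimination.
Variables (k : closedFieldType) (I : choiceType).
Local Notation V := (vect k I).
Local Notation fn := (V -> k).
Local Notation v0 := (vzero I k).
Implicit Types (u v : V) (f g b : fn) (a : V -> {poly k}) (B : fn -> Prop).
Implicit Types (hs : seq (nat * fn)).

Definition zeros hs v : Prop := lall (fun h => h.2 v = 0) hs.

(** Only the orders strictly between 0 and the degree: order 0 is the form itself, and the top order
    is its constant value at [u]. *)
Definition derivs u (h : nat * fn) : seq (nat * fn) :=
  [seq ((h.1 - j)%N, fun v => (line_poly u h.2 v)`_j) | j <- iota 1 h.1.-1].

Lemma derivs_zeros u h v j : zeros (derivs u h) v -> (0 < j < h.1)%N -> (line_poly u h.2 v)`_j = 0.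
Proof.
move/lall_map_seq => H /andP[j0 jh]; apply: (H j); rewrite mem_iota j0 add1n.
by rewrite prednK // (leq_trans _ jh).
Qed.

Lemma derivs_all u h (Q : nat * fn -> Prop) : Pn h.1 h.2 ->
  (forall j f, (0 < j < h.1)%N -> Pn j f -> Q (j, f)) -> lall Q (derivs u h).
Proof.
move=> Ph HQ; apply/lall_map_seq => j; rewrite mem_iota => /andP[j0].
case: h.1 Ph HQ (erefl h.1) => [|n] Ph HQ hE; first by rewrite addn0 ltnNge j0.
rewrite add1n ltnS => jn; apply: HQ.
  by rewrite subn_gt0 ltnS jn ltn_subrL j0.
by apply: (line_homog_line_poly u Ph).1; apply: leqW.
Qed.

Section Fixed.
Variables (d : nat) (B : fn -> Prop) (F : fn).
Hypotheses (gB : good d B) (d0 : (0 < d)%N) (PF : Pn d F).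
Let sB := g_sub gB.

Definition form_in e (h : nat * fn) : Prop := [/\ (0 < h.1 <= e)%N, Pn h.1 h.2 & B h.2].

(* Integrality of [F] over [B] on the common zeros of [hs], with a matrix that is
   uniform in the point. *)
Definition eigen_on hs : Prop := exists (J : finType) (M : J -> J -> fn),
  (forall i j, B (M i j)) /\
  forall v, zeros hs v -> exists x : J -> k, (exists j, x j != 0) /\
    forall i, \sum_j M i j v * x j = F v * x i.

(** As a polynomial in [t], [g (v + t u)] has degree [e] and the nonzero constant [g u] as leading
    coefficient, so division by it stays over [B]. *)
Lemma pow_reduce e g u : (0 < e)%N -> Pn e g -> B g -> g u != 0 -> forall l,
  exists r, [/\ coefs_in B r, forall v, (size (r v) <= e)%N &
    forall v t, g (vlin v t u) = 0 -> t ^+ l = (r v).[t]].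
Proof.
move=> e0 Pg Bg gu; elim=> [|l [r [Pr sr rE]]].
  exists (fun=> 1); split=> [|v|v t _]; [exact: coefs_in_const|by rewrite size_poly1|by rewrite hornerC].
(* Cancels the coefficient of index [e] of ['X * r v]. *)
pose c v := (r v)`_e.-1 * (g u)^-1.
exists (fun v => 'X * r v - (c v)%:P * line_poly u g v); split.
- apply: (coefs_in_B sB); first by apply: (coefs_in_M sB) => //; apply: (coefs_in_const sB).
  apply: (coefs_in_M sB); last exact: (g_line gB u Bg).1.
  apply: (coefs_in_C sB); apply: (sa_mul sB); [exact: Pr.2|exact: (sa_const sB)].
- move=> v; apply/leq_sizeP => j; rewrite leq_eqVlt coefB coefXM coefCM => /orP[/eqP <-|ej].
    by rewrite gtn_eqF // (line_poly_coefn _ _ Pg) /c mulfVK // subrr.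
  rewrite (line_homog_line_poly u Pg).2 // mulr0 subr0 gtn_eqF ?(leq_ltn_trans _ ej) //.
  by rewrite nth_default // (leq_trans (sr v)) // -ltnS prednK // (leq_ltn_trans _ ej).
- move=> v t gt; rewrite exprS (rE v t gt) hornerD hornerN !hornerM hornerX.
  by rewrite -(line_polyE _ _ _ Pg) gt mulr0 subr0.
Qed.

Lemma poly_reduce e g u l (q : V -> {poly k}) : (0 < e)%N -> Pn e g -> B g -> g u != 0 ->
  coefs_in B q -> exists r, [/\ coefs_in B r, forall v, (size (r v) <= e)%N &
    forall v t, g (vlin v t u) = 0 -> t ^+ l * (q v).[t] = (r v).[t]].
Proof.
move=> e0 Pg Bg gu [[N sN] Bq].
have [R RP] := fun_choice (pow_reduce e0 Pg Bg gu).
exists (fun v => \sum_(j < N) ((q v)`_j)%:P * R (l + j)%N v); split.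
- apply: (coefs_in_sum sB) => j; apply: (coefs_in_M sB); first exact: (coefs_in_C sB).
  by case: (RP (l + j)%N).
- move=> v; apply/leq_sizeP => i ei; rewrite coef_sum big1 // => j _; rewrite coefCM.
  by case: (RP (l + j)%N) => _ sR _; rewrite [X in _ * X]nth_default ?mulr0 // (leq_trans (sR v)).
- move=> v t gt; rewrite (horner_coef_wide _ (sN v)) horner_sum big_distrr.
  apply: eq_bigr => j _ /=; rewrite hornerM hornerC.
  by case: (RP (l + j)%N) => _ _ <- //; rewrite exprD mulrCA.
Qed.

Lemma zeros_line hs u v t : lall (fun h => Pn h.1 h.2) hs -> zeros hs u ->
  zeros hs v -> zeros (flatten (map (derivs u) hs)) v -> zeros hs (vlin v t u).
Proof.
rewrite /zeros lall_flatten; elim: hs => //= h' hs IH [Ph Phs] [hu hus] [hv hvs] [dv dvs].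
split; last exact: IH.
rewrite (line_polyE _ _ _ Ph) (horner_coef_wide _ (size_line_poly u v Ph)) big1 // => j _.
have [->|j0] := posnP j; first by rewrite (line_poly_coef0 _ _ Ph) hv mul0r.
have := ltn_ord j; rewrite ltnS leq_eqVlt => /orP[/eqP ->|jn].
  by rewrite (line_poly_coefn _ _ Ph) hu mul0r.
by rewrite (derivs_zeros dv) ?mul0r // j0.
Qed.

(* If v is a zero of [hs] and of its derivatives along u, then v + t u is a zero of [hs] for
   all t, and of g as well for a suitable t, which is integral over B. *)
Lemma eigen_on_step e g u hs : (0 < e)%N -> Pn e g -> B g -> g u != 0 ->
  lall (fun h => Pn h.1 h.2) hs -> zeros hs u ->
  eigen_on ((e, g) :: hs) -> eigen_on (hs ++ flatten (map (derivs u) hs)).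
Proof.
move=> e0 Pg Bg gu Phs hsu [J [M [BM ME]]].
(* Has coefficients in [B] although [F] need not: those of positive index are forms of degree below
   [d]. *)
pose dF v := line_poly u F v - (F v)%:P.
have PdF : coefs_in B dF.
  split; first by exists (maxn d.+1 1) => v; apply: leq_trans (size_polyD _ _) _;
    rewrite size_polyN geq_max !leq_max size_line_poly //= size_polyC_leq1 orbT.
  case=> [|j].
    under [X in B X]functional_extensionality do rewrite coefB coefC (line_poly_coef0 _ _ PF) subrr.
    exact: (sa_const sB).
  under [X in B X]functional_extensionality do rewrite coefB coefC subr0.
  exact: (line_poly_low_in gB d0 PF u j).
(* Subtracting [dF] from the diagonal moves the eigenvalue from [F (v + t u)] to [F v]. *)
pose Q i j v := line_poly u (M i j) v - (i == j)%:R *: dF v.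
have PQ i j : coefs_in B (Q i j).
  apply: (coefs_in_B sB); first exact: (g_line gB u (BM i j)).1.
  under [X in coefs_in _ X]functional_extensionality do rewrite -mul_polyC.
  by apply: (coefs_in_M sB) => //; apply: (coefs_in_const sB).
have [R0 RP0] := fun_choice (fun x : nat * J * J =>
  poly_reduce x.1.1 e0 Pg Bg gu (PQ x.1.2 x.2)).
pose R l i j := R0 (l, i, j).
have RP (l : nat) i j := RP0 (l, i, j).
rewrite /= -/(R _ _ _) in RP.
exists (Finite.clone ('I_e * J)%type _), (fun (x x' : 'I_e * J) v => (R x.1 x.2 x'.2 v)`_x'.1); split.
  by move=> x x'; case: (RP x.1 x.2 x'.2) => [[_ BR] _ _].
move=> v; rewrite /zeros lall_cat => -[hv dv].
have [t gt] : exists t, g (vlin v t u) = 0.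
  have /closed_rootP[t] : size (line_poly u g v) != 1%N.
    rewrite neq_ltn orbC; apply/orP; left; rewrite ltnNge; apply: contra gu => s1.
    by rewrite -(line_poly_coefn u v Pg) nth_default // (leq_trans s1).
  by rewrite /root -(line_polyE _ _ _ Pg) => /eqP; exists t.
have [|x [[j xj] xE]] := ME (vlin v t u).
  by split=> //=; apply: zeros_line.
(* The eigenvector at [v + t u] tensored with the powers of [t] below [e]; the power 0 keeps it
   nonzero. *)
exists (fun z : 'I_e * J => t ^+ z.1 * x z.2); split.
  by exists (Ordinal e0, j); rewrite /= mul1r.
move=> [l i] /=.
rewrite -(pair_bigA _ (fun (b : 'I_e) j => (R l i j v)`_b * (t ^+ b * x j))) exchange_big /=.
transitivity (\sum_j t ^+ l * (Q i j v).[t] * x j).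
  apply: eq_bigr => j' _; case: (RP l i j') => _ sR -> //.
  rewrite (horner_coef_wide _ (sR v)) big_distrl; apply: eq_bigr => b _ /=.
  by rewrite mulrA.
have QE j' : (Q i j' v).[t] = M i j' (vlin v t u) - (i == j')%:R * (F (vlin v t u) - F v).
  rewrite hornerD hornerN hornerZ hornerD hornerN hornerC -(line_polyE _ _ _ PF).
  by rewrite -(g_line gB u (BM i j')).2.
under eq_bigr do rewrite QE mulrBr mulrBl -mulrA.
rewrite sumrB -big_distrr /= xE (bigD1 i) //= eqxx big1 ?addr0 => [|j' ij]; last first.
  by rewrite eq_sym (negPf ij) mul0r mulr0 mul0r.
by rewrite mul1r -mulrA -mulrBr -mulrBl opprB addrCA subrr addr0 mulrCA.
Qed.

Lemma eigen_on_sub hs hs' : (forall v, zeros hs' v -> zeros hs v) -> eigen_on hs -> eigen_on hs'.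
Proof. by move=> sub [J [M [BM ME]]]; exists J, M; split=> // v /sub /ME. Qed.

(** Induction on the top degree and, inside, on the number of forms of that degree: each step
    removes one of them and adds only forms of lower degree. *)
Lemma eigen_on_elim e hs : (e <= d)%N -> lall (form_in e) hs -> eigen_on hs -> eigen_on [::].
Proof.
elim: e hs => [|e IH] hs ed ok ev.
  case: hs ok ev => // h hs [[/andP[h0 h1] _ _] _] _.
  by have := leq_trans h0 h1.
pose top := [seq h <- hs | h.1 == e.+1]; pose low := [seq h <- hs | h.1 != e.+1].
have oktop : lall (fun h => [/\ h.1 = e.+1, Pn h.1 h.2 & B h.2]) top.
  rewrite /top; elim: (hs) ok => //= h l IHl [[_ Ph Bh] /IHl].
  by case: eqP.
have oklow : lall (form_in e) low.
  rewrite /low; elim: (hs) ok => //= h l IHl [[/andP[h0 h1] Ph Bh] /IHl].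
  case: eqP => //= hE Hl; split=> //; split=> //.
  by rewrite h0 /= -ltnS ltn_neqAle h1 andbT; apply/eqP.
have {ev} : eigen_on (top ++ low).
  apply: eigen_on_sub ev => v; rewrite /zeros lall_cat /top /low; elim: (hs) => //= h l IHl.
  by case: eqP => /= _ []; tauto.
move: top low oktop oklow; elim=> [|[n g] top IHtop] low.
  by move=> _ oklow; apply: IH oklow; apply: ltnW.
move=> /= [[nE Pg Bg] oktop] oklow ev; rewrite {}nE in Pg ev.
have [van|nvan] := classic (forall v, zeros (top ++ low) v -> g v = 0).
  apply: (IHtop low) => //; apply: eigen_on_sub ev => v zv; exact: (conj (van v zv) zv).
have [u [zu gu]] : exists u, zeros (top ++ low) u /\ g u != 0.
  apply: NNPP => none; apply: nvan => v zv; apply/eqP/negPn/negP => gv.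
  by apply: none; exists v.
have Pall : lall (fun h => Pn h.1 h.2) (top ++ low).
  by apply/lall_cat; split; [apply: lall_impl oktop|apply: lall_impl oklow] => h [].
have := eigen_on_step (ltn0Sn e) Pg Bg gu Pall zu ev; rewrite -catA; apply: IHtop => //.
apply/lall_cat; split=> //; apply/lall_flatten/lall_cat.
have okd h : (h.1 <= e.+1)%N -> Pn h.1 h.2 -> lall (form_in e) (derivs u h).
  move=> he Ph; apply: derivs_all => // j f /andP[j0 jh] Pf; split=> //=.
    by rewrite j0 /= -ltnS (leq_trans jh).
  by apply: (g_low gB) Pf; rewrite (leq_trans jh) // (leq_trans he).
split.
  by apply: lall_impl oktop => h [hE Ph _]; apply: okd => //; rewrite hE.
by apply: lall_impl oklow => h [/andP[_ he] Ph _]; apply: okd => //; apply: leqW.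
Qed.

Lemma coefs_in_prod (T : Type) (l : seq T) (E : T -> V -> {poly k}) :
  (forall x, coefs_in B (E x)) -> coefs_in B (fun v => \prod_(x <- l) E x v).
Proof.
move=> PE; elim: l => [|x l IH].
  by under [X in coefs_in _ X]functional_extensionality do rewrite big_nil; apply: (coefs_in_const sB).
by under [X in coefs_in _ X]functional_extensionality do rewrite big_cons; apply: (coefs_in_M sB).
Qed.

(** With no condition left, [F v] is an eigenvalue for every [v], and the characteristic polynomial
    is a monic relation over [B]. *)
Lemma eigen_on_in : eigen_on [::] -> B F.
Proof.
case=> J [M [BM ME]].
(* Transposed, because [eigenvalue] refers to row vectors. *)
pose A v := \matrix_(i < #|J|, j < #|J|) M (enum_val j) (enum_val i) v.
apply: (alg_in gB d0 PF); exists (fun v => char_poly (A v)); split; last first.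
  by exists v0; apply: monic_neq0; apply: char_poly_monic.
split.
  apply: (coefs_in_sum sB) => s; apply: (coefs_in_M sB); first exact: (coefs_in_const sB).
  apply: coefs_in_prod => i.
  under [X in coefs_in _ X]functional_extensionality do rewrite !mxE.
  apply: (coefs_in_B sB); first exact: (coefs_in_const sB).
  exact: (coefs_in_C sB).
move=> v; apply/eqP; rewrite -/(root _ _) -eigenvalue_root_char; apply/eigenvalueP.
have [x [[j xj] xE]] := ME v Logic.I.
exists (\row_i x (enum_val i)).
  apply/rowP => i; rewrite !mxE -xE [RHS](reindex (@enum_val J J)) /=.
    by apply: eq_bigr => l _; rewrite !mxE mulrC.
  by exists enum_rank => z _; rewrite ?enum_valK ?enum_rankK.
by apply: contra xj => /eqP /rowP /(_ (enum_rank j)); rewrite !mxE enum_rankK => ->.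
Qed.

End Fixed.

(** The span of [T] plus the forms of finite strength; adding one term at a time leaves the number
    of products implicit. *)
Inductive decomp_mod (d : nat) (T : fn -> Prop) : fn -> Prop :=
| decomp_mod_zero : decomp_mod d T (fun=> 0)
| decomp_mod_gen c h f : T h -> decomp_mod d T f -> decomp_mod d T (fun v => c * h v + f v)
| decomp_mod_prod i j g h f : (0 < i)%N -> (0 < j)%N -> (i + j = d)%N -> Pn i g -> Pn j h ->
    decomp_mod d T f -> decomp_mod d T (fun v => g v * h v + f v).

Lemma decomp_mod_add d T f g : decomp_mod d T f -> decomp_mod d T g -> decomp_mod d T (fun v => f v + g v).
Proof.
move=> Sf Sg; elim: Sf => [|c h f' Th _ IH|i j g' h f' i0 j0 ij Pg Ph _ IH].
- by under [X in decomp_mod _ _ X]functional_extensionality do rewrite add0r.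
- by under [X in decomp_mod _ _ X]functional_extensionality do rewrite -addrA; apply: decomp_mod_gen.
- under [X in decomp_mod _ _ X]functional_extensionality do rewrite -addrA.
  exact: (decomp_mod_prod i0 j0 ij).
Qed.

Lemma decomp_mod_scale d T c f : decomp_mod d T f -> decomp_mod d T (fun v => c * f v).
Proof.
elim=> [|c' h f' Th _ IH|i j g' h f' i0 j0 ij Pg Ph _ IH].
- by under [X in decomp_mod _ _ X]functional_extensionality do rewrite mulr0; apply: decomp_mod_zero.
- by under [X in decomp_mod _ _ X]functional_extensionality do rewrite mulrDr mulrA; apply: decomp_mod_gen.
- under [X in decomp_mod _ _ X]functional_extensionality do rewrite mulrDr mulrA.
  by apply: (decomp_mod_prod i0 j0 ij) => //; apply: PnZ.
Qed.

Lemma vanishing_decomp_mod d (T : fn -> Prop) F top low : (0 < d)%N -> Pn d F ->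
  lall (fun h => Pn d h /\ T h) top ->
  lall (fun h => (0 < h.1 < d)%N /\ Pn h.1 h.2) low ->
  (forall v, lall (fun h => h v = 0) top -> zeros low v -> F v = 0) -> decomp_mod d T F.
Proof.
move=> d0 PF Ptop Plow van.
have Ptop' : lall (Pn d) top by apply: lall_impl Ptop => h [].
have gA : good d (@alg_upto k I d.-1) by rewrite -[d in good d](prednK d0); apply: alg_upto_good.
have gB := adjoins_good d0 gA Ptop'; have sA := g_sub gA.
pose hs := [seq (d, h) | h <- top] ++ low.
have ok : lall (form_in (adjoins (alg_upto d.-1) top) d) hs.
  apply/lall_cat; split.
    apply/lall_map; move: (lall_and Ptop' (adjoins_gen top sA)).
    by apply: lall_impl => h [Ph Bh]; split=> //=; rewrite d0 leqnn.
  apply: lall_impl Plow => h [/andP[h0 hd] Ph]; split=> //; first by rewrite h0 ltnW.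
  by apply: adjoins_incl => //; apply: (g_low gA) Ph.
(* On the zeros of [hs] the value of [F] is 0, an eigenvalue of the zero matrix of size 1. *)
have ev : eigen_on (adjoins (alg_upto d.-1) top) F hs.
  exists (Finite.clone unit _), (fun _ _ _ => 0); split=> [_ _|v]; first exact: (sa_const (g_sub gB)).
  rewrite /zeros lall_cat lall_map => -[tv lv]; exists (fun=> 1).
  split; first by exists tt; apply: oner_neq0.
  by move=> _; rewrite big1 => [|_ _]; rewrite ?mul0r // van ?mul0r.
have BF := eigen_on_in gB d0 PF (eigen_on_elim gB d0 PF (leqnn d) ok ev).
apply: (adjoins_alg_upto_homog d0 (decomp_mod_zero d T) _ _ _ _ PF BF).
- exact: decomp_mod_add.
- exact: decomp_mod_scale.
- move=> i j f g i0 j0 ij Pf Pg.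
  have := decomp_mod_prod i0 j0 ij Pf Pg (decomp_mod_zero d T); congr (decomp_mod _ _ _).
  by apply: functional_extensionality => v; rewrite addr0.
- apply: lall_impl Ptop => h [Ph Th]; split=> //.
  have := decomp_mod_gen 1 Th (decomp_mod_zero d T); congr (decomp_mod _ _ _).
  by apply: functional_extensionality => v; rewrite addr0 mul1r.
Qed.

End Elimination.

(** * Strength *)

Section Strength.
Variables (k : closedFieldType) (I : choiceType).
Local Notation V := (vect k I).
Local Notation fn := (V -> k).
Local Notation v0 := (vzero I k).

Lemma peval_sum (n : nat) (T : Type) (l : seq T) (P : pred T) (s : T -> series k I) v :
  peval n (fun m => \sum_(x <- l | P x) s x m) v = \sum_(x <- l | P x) peval n (s x) v.
Proof.
rewrite /peval exchange_big /=; apply: eq_bigr => m _.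
by rewrite big_distrl.
Qed.

Lemma pevalZ (n : nat) c (s : series k I) v : peval n (fun m => c * s m) v = c * peval n s v.
Proof. by rewrite /peval big_distrr /=; apply: eq_bigr => m _; rewrite mulrA. Qed.

Lemma pevalD (n : nat) (s s' : series k I) v :
  peval n (fun m => s m + s' m) v = peval n s v + peval n s' v.
Proof. by rewrite /peval -big_split; apply: eq_bigr => m _; rewrite mulrDl. Qed.

Lemma peval0 (n : nat) (v : V) : peval n (fun=> 0) v = 0.
Proof. by rewrite /peval big1 // => m _; rewrite mul0r. Qed.

Lemma homog_sum (n : nat) (T : Type) (l : seq T) (P : pred T) (s : T -> series k I) :
  (forall x, P x -> homog n (s x)) -> homog n (fun m => \sum_(x <- l | P x) s x m).
Proof.
move=> hs m; apply: contraNeq => dm; rewrite big1 // => x Px.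
by apply/eqP; apply: contraR dm => /(hs x Px) ->.
Qed.

Lemma homogZ (n : nat) c (s : series k I) : homog n s -> homog n (fun m => c * s m).
Proof. by move=> hs m; rewrite mulf_eq0 negb_or => /andP[_ /hs]. Qed.

Lemma strength_le_add (n i j s : nat) (g h f : series k I) :
  (0 < i < n)%N -> (0 < j < n)%N -> homog i g -> homog j h -> strength_le n f s ->
  strength_le n (fun m => smul g h m + f m) s.+1.
Proof.
move=> ci cj hg hh [gs [hs [dg [dh [H ->]]]]].
pose ext T (x : T) (xs : 'I_s -> T) (l : 'I_s.+1) := if unlift ord0 l is Some l' then xs l' else x.
exists (ext _ g gs), (ext _ h hs), (ext _ i dg), (ext _ j dh); split.
  by move=> l; rewrite /ext; case: unliftP => [l' _|_] //; apply: H.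
apply: functional_extensionality => m; rewrite big_ord_recl {1 2}/ext unlift_none.
by congr (_ + _); apply: eq_bigr => l _; rewrite /ext liftK.
Qed.

(** * Solving the equations one form at a time *)

Section Family.
Variables (r : nat) (d : 'I_r -> nat) (f : 'I_r -> series k I).
Hypotheses (hdeg : forall i, (0 < d i)%N) (hhom : forall i, homog (d i) (f i)).
Hypothesis hstr : inf_coll_strength d f.
Let phi i : fn := peval (d i) (f i).
Let Pphi i : Pn (d i) (phi i) := Pn_peval (d i) (f i).

(** The condition [a i = 0] records that only the other forms of the degree occur; it keeps the
    combination nontrivial when [F] is [phi i]. *)
Lemma decomp_mod_strength i F : decomp_mod (d i) (fun h => exists j, [/\ j != i, d j = d i & h = phi j]) F ->
  exists (a : 'I_r -> k) (s : series k I) (l : nat),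
    [/\ a i = 0, homog (d i) s, strength_le (d i) s l &
      forall v, F v = \sum_(j | d j == d i) a j * phi j v + peval (d i) s v].
Proof.
elim=> [|c h F' [j [ji dj ->]] _ [a [s [l [ai hs sl FE]]]]
       |x y g h F' x0 y0 xy Pg Ph _ [a [s [l [ai hs sl FE]]]]].
- exists (fun=> 0), (fun=> 0), 0%N; split=> //.
  + by move=> m; rewrite eqxx.
  + exists (fun _ _ => 0), (fun _ _ => 0), (fun=> 0%N), (fun=> 0%N); split; first by case.
    by apply: functional_extensionality => m; rewrite big_ord0.
  + by move=> v; rewrite peval0 addr0 big1 // => j _; rewrite mul0r.
- exists (fun j' => a j' + (if j' == j then c else 0)), s, l; split=> //.
    by rewrite eq_sym (negPf ji) addr0.
  move=> v; rewrite FE addrA; congr (_ + _).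
  under [RHS]eq_bigr do rewrite mulrDl.
  rewrite big_split addrC /=; congr (_ + _).
  rewrite (bigD1 j) ?dj //= eqxx big1 ?addr0 // => j' /andP[_ /negPf ->].
  by rewrite mul0r.
have [g' [hg gE]] := Pn_series Pg; have [h' [hh hE]] := Pn_series Ph.
exists a, (fun m => smul g' h' m + s m), l.+1; split=> //.
- move=> m; apply: contraNeq => dm; apply/eqP.
  have -> : smul g' h' m = 0.
    by apply/eqP; apply: contraR dm => /(homog_smul hg hh) ->; rewrite xy.
  by have -> : s m = 0 by [apply/eqP; apply: contraR dm => /hs ->]; rewrite addr0.
- apply: (strength_le_add (i := x) (j := y)) => //.
    by rewrite x0 -xy -{1}[x]addn0 ltn_add2l.
  by rewrite y0 -xy -{1}[y]add0n ltn_add2r.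
- move=> v; rewrite FE pevalD -xy (peval_smul _ hg hh) gE hE addrA [_ * _ + _]addrC.
  by rewrite addrA.
Qed.

(** Otherwise [f i] minus a combination of the other forms of its degree would have finite strength,
    while [f i] occurs in it with coefficient 1. *)
Lemma phi_notin_decomp_mod i : ~ decomp_mod (d i) (fun h => exists j, [/\ j != i, d j = d i & h = phi j]) (phi i).
Proof.
move/decomp_mod_strength => [a [s [l [ai hs sl phiE]]]].
pose a' j := (if j == i then 1 else 0) - a j.
apply: (hstr (n := d i) (a := a')) (l) _.
  by exists i; split=> //; rewrite /a' eqxx ai subr0 oner_neq0.
suff -> : (fun m => \sum_(j < r | d j == d i) a' j * f j m) = s by [].
apply: (@peval_inj _ _ (d i)) => //.
  by apply: homog_sum => j /eqP <-; apply: homogZ.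
move=> v; rewrite peval_sum.
have -> : \sum_(j < r | d j == d i) peval (d i) (fun m => a' j * f j m) v =
          \sum_(j < r | d j == d i) a' j * phi j v.
  by apply: eq_bigr => j /eqP dj; rewrite pevalZ -dj.
under eq_bigr do rewrite mulrBl.
rewrite sumrB (bigD1 i) //= eqxx mul1r big1 ?addr0 => [|j /andP[_ /negPf ->]]; last by rewrite mul0r.
by rewrite phiE addrAC subrr add0r.
Qed.

Lemma extend_solution (c : 'I_r -> k) (S : seq 'I_r) i v :
  i \notin S -> (forall j, j \in S -> (d j <= d i)%N) -> (forall j, j \in S -> phi j v = c j) ->
  exists w, forall j, j \in i :: S -> phi j w = c j.
Proof.
move=> iS dS cS.
(* Forms of degree [d i] are kept apart, since [phi i] is compared with their span. The mixed terms
   have degree below [d i] even for [j = i]. *)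
pose top := [seq phi j | j <- S & d j == d i].
pose low := [seq (d j, phi j) | j <- S & d j != d i] ++
            flatten [seq derivs v (d j, phi j) | j <- i :: S].
have [w [[ztop zlow] nz]] : exists w, (lall (fun h => h w = 0) top /\ zeros low w) /\ phi i w != 0.
  apply: NNPP => none; apply: (@phi_notin_decomp_mod i); apply: (@vanishing_decomp_mod _ _ _ _ _ top low) => //.
  - apply/lall_map_seq => j; rewrite mem_filter => /andP[/eqP dj jS]; split.
      by rewrite -dj.
    by exists j; split=> //; apply: contraNneq iS => <-.
  - apply/lall_cat; split.
      apply/lall_map_seq => j; rewrite mem_filter => /andP[dj jS] /=; split=> //.
      by rewrite hdeg ltn_neqAle dj dS.
    apply/lall_flatten/lall_seqP => j jS; apply: derivs_all => //= x g /andP[x0 xj] Pg.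
    split=> //; rewrite x0 (leq_trans xj) //.
    by move: jS; rewrite inE => /orP[/eqP ->|/dS].
  - by move=> w zt zl; apply/eqP/negPn/negP => nz; apply: none; exists w.
have [zlow1 zlow2] := (lall_cat _ _ _).1 zlow.
have [t tE] := exists_root ((c i - phi i v) / phi i w) (hdeg i).
exists (vlin (vlin v0 t w) 1 v) => j jS.
have dj : zeros (derivs v (d j, phi j)) w.
  by move/lall_flatten/lall_seqP: zlow2 => /(_ j jS).
(* Expansion from the point [t w] in the direction [v]: index 0 gives the first term, the top index
   gives [phi j v], and the mixed terms vanish at [t w] because they are homogeneous and vanish at
   [w]. *)
have -> : phi j (vlin (vlin v0 t w) 1 v) = t ^+ d j * phi j w + phi j v.
  rewrite (line_polyE _ _ _ (Pphi j)) (horner_coef_wide _ (size_line_poly _ _ (Pphi j))).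
  rewrite big_ord_recr -(prednK (hdeg j)) big_ord_recl /= big1 ?addr0 => [|l _].
    rewrite prednK // (line_poly_coef0 _ _ (Pphi j)) (line_poly_coefn _ _ (Pphi j)).
    by rewrite (Pn_scale _ _ (Pphi j)) !expr1n !mulr1.
  have ld : (0 < l.+1 < d j)%N by have := ltn_ord l; rewrite -ltnS (prednK (hdeg j)).
  have lj : (l.+1 <= d j)%N by case/andP: ld => _ /ltnW.
  have E := Pn_scale t w ((line_homog_line_poly v (Pphi j)).1 l.+1 lj).
  by rewrite -[bump 0 l]/(l.+1) {}E (derivs_zeros dj ld) mulr0 mul0r.
move: jS; rewrite inE => /orP[/eqP ->|jS].
  by rewrite tE mulfVK // subrK.
have -> : phi j w = 0; last by rewrite mulr0 add0r cS.
have [dji|dji] := boolP (d j == d i).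
  by move/lall_map_seq: ztop => /(_ j); apply; rewrite mem_filter dji.
by move/lall_map_seq: zlow1 => /(_ j); apply; rewrite mem_filter dji.
Qed.

Lemma solution (c : 'I_r -> k) : exists v, forall i, phi i v = c i.
Proof.
pose le i j := (d i <= d j)%N.
have tot : total le by move=> i j; apply: leq_total.
have tr : transitive le by move=> j i l; apply: leq_trans.
(* Reversed, because induction on the list treats its head last and the head must have the largest
   degree. *)
suff [v vE] : exists v, forall i, i \in rev (sort le (enum 'I_r)) -> phi i v = c i.
  by exists v => i; apply: vE; rewrite mem_rev mem_sort mem_enum.
have : sorted (fun i j => le j i) (rev (sort le (enum 'I_r))).
  by rewrite rev_sorted; apply: sort_sorted.
have : uniq (rev (sort le (enum 'I_r))) by rewrite rev_uniq sort_uniq enum_uniq.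
elim: (rev _) => [|i S IH]; first by exists v0.
rewrite cons_uniq => /andP[iS uS] /= pS.
have [v vE] := IH uS (path_sorted pS).
apply: extend_solution vE => // j jS.
have tr' : transitive (fun i j => le j i) by move=> x y z xy yz; apply: tr yz xy.
exact: (allP (order_path_min tr' pS)).
Qed.

End Family.
End Strength.

Theorem theorem2p1 (k : closedFieldType) (I : choiceType) (r : nat)
    (d : 'I_r -> nat) (f : 'I_r -> series k I)
    (hdeg : forall i, (0 < d i)%N)
    (hhom : forall i, homog (d i) (f i))
    (hstr : inf_coll_strength d f)
    (c : 'I_r -> k) :
  exists v : vect k I, forall i, peval (d i) (f i) v = c i.
Proof. exact: solution. Qed.
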